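(* For every fixed integer $k\ge 1$, the decision problem $\mathrm{ARM}(k)$ belongs to $\exists\mathbb{R}$.
   Context: For $A,X\in\mathbb{R}^{m\times n}$ write $\langle A,X\rangle=\sum_{i=1}^m\sum_{j=1}^n A_{ij}X_{ij}$. For a fixed integer $k\ge 1$, $\mathrm{ARM}(k)$ (Affine Rank Minimization) is the following decision problem. Input: matrices $A_1,\dots,A_q\in\mathbb{Q}^{m\times n}$ and scalars $b_1,\dots,b_q\in\mathbb{Q}$. Question: does there exist $X\in\mathbb{R}^{m\times n}$ such that $\langle A_\ell,X\rangle=b_\ell$ for all $\ell\in\{1,\dots,q\}$ and $\operatorname{rank}(X)\le k$? All rationals are encoded in binary in reduced form; the instance length is the total bit-length of all numerators and denominators of all entries of all $A_\ell$ and all $b_\ell$, plus the encoding of $(m,n,q)$. ETR (existential theory of the reals): an instance is a sentence $\exists x\in\mathbb{R}^N:\varphi(x)$, where $\varphi$ is a quantifier-free Boolean combination (using $\wedge,\vee,\neg$) of atomic predicates $p(x)=0$, $p(x)\ne 0$, $p(x)\ge 0$, $p(x)>0$ with $p\in\mathbb{Z}[x_1,\dots,x_N]$; polynomials are given in sparse form with binary coefficients. The question is whether the sentence is true. A language is in $\exists\mathbb{R}$ if it is polynomial-time many-one reducible to ETR. *)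

(* Defs.v *)
From HB Require Import structures.
From mathcomp Require Import all_boot all_order all_algebra.
From mathcomp Require Import reals.
Set Implicit Arguments.
Unset Strict Implicit.
Unset Printing Implicit Defensive.
Import Order.TTheory GRing.Theory Num.Theory.

Inductive move := MoveL | MoveN | MoveR.

(* Tape symbols: [None] is the blank, [Some (inl b)] an input/output bit, and
   [Some (inr a)] an auxiliary symbol of the machine. *)
Definition symbol (A : Type) := option (bool + A).

Record tm := TM {
  tm_aux : finType;
  tm_state : finType;
  tm_tapes : nat; (* the machine has [tm_tapes.+1] tapes *)
  tm_start : tm_state;
  tm_halt : pred tm_state;
  tm_delta : tm_state -> {ffun 'I_tm_tapes.+1 -> symbol tm_aux} ->
             tm_state * {ffun 'I_tm_tapes.+1 -> symbol tm_aux * move} }.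

(* A two-way infinite tape [(l, r)]: the head scans the first symbol of [r], and
   [l] lists the symbols to the left of the head, nearest first.  Cells beyond
   the ends of both lists are blank. *)
Definition tape (A : Type) := (seq (symbol A) * seq (symbol A))%type.

Definition tape_read A (t : tape A) : symbol A := head None t.2.

Definition tape_act A (am : symbol A * move) (t : tape A) : tape A :=
  let: (a, m) := am in
  let: (l, r) := (t.1, a :: behead t.2) in
  match m with
  | MoveL => (behead l, head None l :: r)
  | MoveN => (l, r)
  | MoveR => (a :: l, behead r)
  end.

Section Run.
Variable M : tm.

Definition config := (tm_state M * ('I_(tm_tapes M).+1 -> tape (tm_aux M)))%type.

Definition step (c : config) : config :=
  if tm_halt c.1 then c else
  let: (s, act) := tm_delta c.1 [ffun i => tape_read (c.2 i)] in
  (s, fun i => tape_act (act i) (c.2 i)).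

Definition init (w : seq bool) : config :=
  (tm_start M,
   fun i => if i == ord0 then ([::], [seq Some (inl b) | b <- w])
            else ([::], [::])).

Fixpoint leading_bits A (r : seq (symbol A)) : seq bool :=
  if r is Some (inl b) :: r' then b :: leading_bits r' else [::].

(* The output is written on the first tape, starting at the head, up to the
   first cell that does not contain a bit. *)
Definition output (c : config) : seq bool := leading_bits (c.2 ord0).2.

End Run.

Definition polytime (f : seq bool -> seq bool) : Prop :=
  exists (M : tm) (c d : nat), forall w : seq bool,
    exists2 t : nat, t <= c * (size w).+1 ^ d &
      let: final := iter t (@step M) (init M w) in
      tm_halt final.1 /\ output final = f w.

Definition language := seq bool -> Prop.

Definition poly_reducible (L1 L2 : language) : Prop :=
  exists2 f : seq bool -> seq bool,
    polytime f & forall w : seq bool, L1 w <-> L2 (f w).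

(* [up_log 2 n.+1] is the bit-length of [n]; least significant bit first. *)
Definition bits (n : nat) : seq bool :=
  mkseq (fun i => odd (n %/ 2 ^ i)) (up_log 2 n.+1).

(* Each item is preceded by a continuation bit, so that if [enc] is a prefix
   code then so is [enc_seq enc]. *)
Definition enc_seq T (enc : T -> seq bool) (s : seq T) : seq bool :=
  flatten [seq true :: enc x | x <- s] ++ [:: false].

Definition enc_nat (n : nat) : seq bool := enc_seq (fun b => [:: b]) (bits n).

Definition enc_unary (n : nat) : seq bool := nseq n true ++ [:: false].

Definition enc_int (z : int) : seq bool := (z < 0)%R :: enc_nat `|z|%N.

(* [numq] and [denq] are coprime, and [denq] is positive. *)
Definition enc_rat (r : rat) : seq bool :=
  enc_int (numq r) ++ enc_nat `|denq r|%N.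

(* A polynomial in [N] variables over the integers, in sparse form: a list of
   coefficients paired with exponent vectors. *)
Definition spoly (N : nat) := seq (int * N.-tuple nat).

Inductive cmp := EqZero | NeqZero | GeZero | GtZero.

Inductive formula (N : nat) :=
  | Atom of cmp & spoly N
  | And of formula N & formula N
  | Or of formula N & formula N
  | Not of formula N.

Section Semantics.
Variables (R : realType) (N : nat) (x : 'I_N -> R).
Local Open Scope ring_scope.

Definition eval_spoly (p : spoly N) : R :=
  \sum_(ce <- p) ce.1%:~R * \prod_(i < N) x i ^+ tnth ce.2 i.

Definition eval_cmp (c : cmp) (v : R) : Prop :=
  match c with
  | EqZero => v = 0
  | NeqZero => v <> 0
  | GeZero => v >= 0
  | GtZero => v > 0
  end.

Fixpoint holds (phi : formula N) : Prop :=
  match phi with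
  | Atom c p => eval_cmp c (eval_spoly p)
  | And phi1 phi2 => holds phi1 /\ holds phi2
  | Or phi1 phi2 => holds phi1 \/ holds phi2
  | Not phi1 => ~ holds phi1
  end.

End Semantics.

(* Coefficients are in binary; exponents are in unary, so that the degree of a
   polynomial is at most the length of its encoding. *)
Definition enc_spoly N (p : spoly N) : seq bool :=
  enc_seq (fun ce : int * N.-tuple nat =>
             enc_int ce.1 ++ flatten [seq enc_unary e | e <- ce.2]) p.

Definition enc_cmp (c : cmp) : seq bool :=
  match c with
  | EqZero => [:: false; false]
  | NeqZero => [:: false; true]
  | GeZero => [:: true; false]
  | GtZero => [:: true; true]
  end.

Fixpoint enc_formula N (phi : formula N) : seq bool :=
  match phi with
  | Atom c p => [:: false; false] ++ enc_cmp c ++ enc_spoly p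
  | And phi1 phi2 => [:: false; true] ++ enc_formula phi1 ++ enc_formula phi2
  | Or phi1 phi2 => [:: true; false] ++ enc_formula phi1 ++ enc_formula phi2
  | Not phi1 => [:: true; true] ++ enc_formula phi1
  end.

Record etr_instance := ETRInstance {
  etr_N : nat;
  etr_matrix : formula etr_N }.

(* [N] is in unary because the quantifier prefix lists the [N] variables. *)
Definition enc_etr (I : etr_instance) : seq bool :=
  enc_unary (etr_N I) ++ enc_formula (etr_matrix I).

Definition etr_true (R : realType) (I : etr_instance) : Prop :=
  exists x : 'I_(etr_N I) -> R, holds x (etr_matrix I).

Definition ETR (R : realType) : language := fun w =>
  exists2 I : etr_instance, w = enc_etr I & etr_true R I.

Definition in_existsR (R : realType) (L : language) : Prop :=
  poly_reducible L (ETR R).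

Record arm_instance := ARMInstance {
  arm_m : nat;
  arm_n : nat;
  arm_q : nat;
  arm_A : 'I_arm_q -> 'M[rat]_(arm_m, arm_n);
  arm_b : 'I_arm_q -> rat }.

Definition enc_arm (I : arm_instance) : seq bool :=
  enc_nat (arm_m I) ++ enc_nat (arm_n I) ++ enc_nat (arm_q I) ++
  flatten [seq flatten [seq flatten [seq enc_rat (arm_A l i j)
                                    | j <- enum 'I_(arm_n I)]
                       | i <- enum 'I_(arm_m I)]
               ++ enc_rat (arm_b l)
          | l <- enum 'I_(arm_q I)].

Definition mxdot (R : realType) m n (A X : 'M[R]_(m, n)) : R :=
  (\sum_(i < m) \sum_(j < n) A i j * X i j)%R.

Definition arm_feasible (R : realType) (k : nat) (I : arm_instance) : Prop :=
  exists X : 'M[R]_(arm_m I, arm_n I),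
    (forall l, mxdot (map_mx ratr (arm_A l)) X = ratr (arm_b l)) /\
    \rank X <= k.

Definition ARM (R : realType) (k : nat) : language := fun w =>
  exists2 I : arm_instance, w = enc_arm I & arm_feasible R k I.

(* Main.v *)
From HB Require Import structures.
Require Import Defs.
From mathcomp Require Import all_boot all_order all_algebra.
From mathcomp Require Import boolp reals.
From mathcomp Require Import zify ring.
Set Implicit Arguments.
Unset Strict Implicit.
Unset Printing Implicit Defensive.
Import Order.TTheory GRing.Theory Num.Theory.

(* Almost all the work is left to the existential formula, so that the machine
   only has to write down a very uniform one.  The input w is put between two
   end markers, and every position carries a state vector of d real variables,
   d depending on k only.  The formula is the conjunction, over all pairs of
   positions, of one of finitely many fixed formulas in the 2d variables of the
   two positions, chosen according to the symbols there and to whether the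
   positions are adjacent.  A machine writes it by moving two marks over a copy
   of w.

   For adjacent positions the formula says that the second state vector follows
   from the first one by a step of a nondeterministic automaton with real
   registers that reads w bit by bit.  The automaton parses the instance,
   guesses Bezout coefficients to check that fractions are reduced, and
   accumulates <A_l, X> for X = UV with U of width k.  The row i of U and the
   column j of V are guessed whenever they are used; for arbitrary pairs of
   positions, the formula says that the guesses made for the same i (or j)
   agree, so that they do come from a single factorization. *)

(** * Sweeping machines run in polynomial time *)

Inductive phase := PStart | PCopy | PSweep | PRewind | PHalt.
Definition phase_code p : 'I_5 :=
  match p with
  | PStart => @Ordinal 5 0 isT | PCopy => @Ordinal 5 1 isT
  | PSweep => @Ordinal 5 2 isT | PRewind => @Ordinal 5 3 isT
  | PHalt => @Ordinal 5 4 isT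
  end.
Definition phase_decode (i : 'I_5) : phase :=
  nth PStart [:: PStart; PCopy; PSweep; PRewind; PHalt] i.
Lemma phase_codeK : cancel phase_code phase_decode.
Proof. by case. Qed.
HB.instance Definition _ := Finite.copy phase (can_type phase_codeK).

(** Half-tapes are compared cell by cell, since lists that differ only by trailing blanks represent
    the same contents. *)
Definition same A (a b : seq (symbol A)) := nth None a =1 nth None b.

Section Same.
Variable A : Type.
Implicit Types (a b : seq (symbol A)) (t : tape A).

Lemma same_cons x a b : same a b -> same (x :: a) (x :: b).
Proof. by move=> ab [|i] //=; apply: ab. Qed.

Lemma same_behead a b : same a b -> same (behead a) (behead b).
Proof. by move=> ab i; rewrite !nth_behead. Qed.

Lemma same_head a b : same a b -> head None a = head None b.
Proof. by move=> /(_ 0); rewrite !nth0. Qed.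

Lemma same_None a : same a [::] -> same (None :: a) [::].
Proof. by move=> ab [|i] //=; rewrite ab nth_nil. Qed.

Lemma same_eta a : same (head None a :: behead a) a.
Proof. by case: a => [|x a] [|i] //=; rewrite nth_nil. Qed.

Lemma same_leading_bits a b : same a b -> leading_bits a = leading_bits b.
Proof.
elim: a b => [|x a IH] b /= ab.
  by case: b ab => [|[[c|c]|] b] //= /(_ 0).
have := same_head ab; case: b ab => [|y b] /= ab.
  by move=> ->.
by move=> ->; case: y {ab} (same_behead ab) => [[c|c]|] //= /IH ->.
Qed.

Lemma leading_bits_map (o : seq bool) :
  leading_bits [seq Some (inl c) : symbol A | c <- o] = o.
Proof. by elim: o => //= b o ->. Qed.
End Same.

(* A sweeper rewrites a word of cells by repeated one-way passes of a finite
   transducer, which also prepends bits to an output. *)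
Record sweeper := Sweeper {
  sw_state : finType;
  sw_cell : finType;
  sw_start : sw_state;
  sw_first : sw_cell;
  sw_last : sw_cell;
  sw_bit : bool -> sw_cell;
  sw_step : sw_state -> sw_cell -> sw_state * sw_cell * seq bool;
  sw_end : sw_state -> sw_state * seq bool;
  sw_halt : pred sw_state }.

Section Sweep.
Variable W : sweeper.
Notation S := (sw_state W).
Notation C := (sw_cell W).

Definition snapshot := (S * seq C * seq bool)%type.

Fixpoint sweep (s : S) (u : seq C) (o : seq bool) : snapshot :=
  if u is c :: u1 then
    let: (s1, c1, o1) := sw_step s c in
    let: (s2, u2, o2) := sweep s1 u1 (o1 ++ o) in
    (s2, c1 :: u2, o2)
  else (s, [::], o).

Definition sweep_round (x : snapshot) : snapshot :=
  let: (s, u, o) := x in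
  let: (s1, u1, o1) := sweep s u o in
  let: (s2, o2) := sw_end s1 in
  (s2, u1, o2 ++ o1).

(** Copying the input leaves the head to the right of the last cell and passes go leftwards, so the
    cells are listed from right to left. *)
Definition sweep_init (w : seq bool) : seq C :=
  sw_last W :: rcons (rev [seq sw_bit W b | b <- w]) (sw_first W).

Inductive sweeps : nat -> snapshot -> snapshot -> Prop :=
| Sweeps0 x : sweeps 0 x x
| SweepsS n x y : ~~ sw_halt x.1.1 -> sweeps n (sweep_round x) y ->
    sweeps n.+1 x y.

Lemma sweeps_trans n1 n2 x y z :
  sweeps n1 x y -> sweeps n2 y z -> sweeps (n1 + n2) x z.
Proof. by elim=> // n {}x {}y h _ IH /IH yz; apply: SweepsS. Qed.

Lemma sweeps1 x : ~~ sw_halt x.1.1 -> sweeps 1 x (sweep_round x).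
Proof. by move=> h; apply: SweepsS => //; apply: Sweeps0. Qed.

Lemma size_sweep s u o : size (sweep s u o).1.2 = size u.
Proof.
elim: u s o => //= c u IH s o.
case: sw_step => [[s1 c1] o1]; have := IH s1 (o1 ++ o).
by case: sweep => [[s2 u2] o2] /= ->.
Qed.

(** Bounds the bits produced by one transition, so that those waiting to be written fit in the
    finite control. *)
Definition sw_width :=
  maxn (\max_(x : S * C) size (sw_step x.1 x.2).2)
       (\max_(s : S) size (sw_end s).2).
Notation K := sw_width.

Lemma sw_step_width (s : S) (c : C) : size (sw_step s c).2 <= K.
Proof.
by rewrite leq_max (leq_bigmax (F := fun x : S * C => size (sw_step x.1 x.2).2) (s, c)).
Qed.

Lemma sw_end_width (s : S) : size (sw_end s).2 <= K.
Proof.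
by rewrite leq_max (leq_bigmax (F := fun s : S => size (sw_end s).2) s) orbT.
Qed.

Definition tm_st := (phase * S * K.-bseq bool)%type.

(** Reversed because each written bit lands in front of the earlier ones: the last bit has to be
    written first. *)
Definition queue (o : seq bool) : K.-bseq bool := insub_bseq K (rev o).

Lemma queueE o : size o <= K -> queue o = rev o :> seq bool.
Proof. by move=> h; rewrite /queue /insub_bseq val_insubd size_rev h. Qed.

Definition pairf A (x y : A) : {ffun 'I_2 -> A} :=
  [ffun i : 'I_2 => if i == ord0 then x else y].

(* The output is written on the first tape from right to left, so that prepending
   a bit is a single step; the bits still to be written are in the state. *)
Definition sweep_delta (x : tm_st) (rd : {ffun 'I_2 -> symbol C}) :
    tm_st * {ffun 'I_2 -> symbol C * move} :=
  let: (p, s, q) := x in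
  let: (r0, r1) := (rd ord0, rd ord_max : symbol C) in
  if q : seq bool is b :: _ then
    ((p, s, insub_bseq K (behead q)), pairf (Some (inl b), MoveL) (r1, MoveN))
  else match p with
  | PStart =>
      ((PCopy, s, q), pairf (r0, MoveN) (Some (inr (sw_first W)), MoveR))
  | PCopy =>
      if r0 is Some (inl b) then
        ((PCopy, s, q), pairf (None, MoveR) (Some (inr (sw_bit W b)), MoveR))
      else
        ((PRewind, s, q), pairf (None, MoveN) (Some (inr (sw_last W)), MoveR))
  | PSweep =>
      if r1 is Some (inr c) then
        let: (s1, c1, o1) := sw_step s c in
        ((PSweep, s1, queue o1),
         pairf (r0, MoveN) (Some (inr c1), MoveL))
      else
        let: (s1, o1) := sw_end s in
        ((PRewind, s1, queue o1), pairf (r0, MoveN) (None, MoveR))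
  | PRewind =>
      if r1 is Some _ then
        ((PRewind, s, q), pairf (r0, MoveN) (r1, MoveR))
      else if sw_halt s then
        ((PHalt, s, q), pairf (None, MoveR) (None, MoveN))
      else
        ((PSweep, s, q), pairf (r0, MoveN) (None, MoveL))
  | PHalt => (x, pairf (r0, MoveN) (r1, MoveN))
  end.

Definition sweep_tm : tm :=
  @TM C tm_st 1 (PStart, sw_start W, [bseq])
     (fun x => x.1.1 == PHalt) sweep_delta.

Notation cfg := (config sweep_tm).
Notation stp := (@step sweep_tm).

Definition cellsym (c : C) : symbol C := Some (inr c).
Definition bitsym (b : bool) : symbol C := Some (inl b).

(** The head waits on the cell just left of the output, which the next bit will overwrite and whose
    content is left free. *)
Definition out_tape (t : tape C) (o : seq bool) :=
  same t.1 [::] /\ same (behead t.2) (map bitsym o).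

Definition work_tape (t : tape C) (l r : seq (symbol C)) :=
  same t.1 l /\ same t.2 r.

Definition at_cfg (p : phase) s (q o : seq bool) (l r : seq (symbol C)) (c : cfg) :=
  [/\ c.1.1 = (p, s), c.1.2 = q :> seq bool, out_tape (c.2 ord0) o &
      work_tape (c.2 ord_max) l r].

Definition reach n (P : cfg -> Prop) (c : cfg) :=
  exists2 t, t <= n & P (iter t stp c).

Lemma reach_trans n m (P Q : cfg -> Prop) c :
  reach n P c -> (forall c', P c' -> reach m Q c') -> reach (n + m) Q c.
Proof.
move=> [t tn Pc] /(_ _ Pc) [t' tm Qc]; exists (t' + t); first by lia.
by rewrite iterD.
Qed.

Lemma reach_le n m (P : cfg -> Prop) c : n <= m -> reach n P c -> reach m P c.
Proof. by move=> nm [t tn Pc]; exists t => //; apply: leq_trans nm. Qed.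

Lemma reach0 n (P : cfg -> Prop) c : P c -> reach n P c.
Proof. by move=> Pc; exists 0. Qed.

Lemma reachS n (P : cfg -> Prop) c : reach n P (stp c) -> reach n.+1 P c.
Proof. by move=> [t tn Pc]; exists t.+1 => //; rewrite iterSr. Qed.

Lemma stepE (c : cfg) p s q :
  c.1.1 = (p, s) -> c.1.2 = q -> p != PHalt ->
  stp c =
  let: (x, act) := sweep_delta (p, s, q)
     [ffun i => tape_read (c.2 i)] in
  (x, fun i => tape_act (act i) (c.2 i)).
Proof.
case: c => [[[p' s'] q'] t] /= [-> ->] -> np.
by rewrite /step /= (negbTE np).
Qed.

Lemma flush p s q o l r c : p != PHalt ->
  at_cfg p s q o l r c ->
  reach (size q) (at_cfg p s [::] (rev q ++ o) l r) c.
Proof.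
move=> np; elim: q o c => [|b q IH] o c Hc; first exact: reach0.
apply: reachS.
rewrite rev_cons cat_rcons; apply: (IH (b :: o)).
case: Hc => [c1 c2 [o1 o2] [w1 w2]].
rewrite (stepE c1 erefl np) /sweep_delta c2 /=.
split=> //=.
- move: c2; case: (c.1.2) => [q0 /= sq] E; rewrite /insub_bseq val_insubd.
  by move: sq; rewrite E /= => /ltnW ->.
- rewrite !ffunE /=; split=> /=; first exact: (same_behead o1).
  exact: same_cons.
- rewrite !ffunE /=; split=> //=; rewrite /tape_read (same_head w2) => i.
  by rewrite -(same_eta r); apply: same_cons; apply: same_behead.
Qed.

Lemma out_tape_id t o : out_tape t o -> out_tape (tape_act (tape_read t, MoveN) t) o.
Proof. by case. Qed.

Notation cells u := (map cellsym u).

(** [d] holds the cells already rewritten, now to the right of the head. Each cell costs one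
    transition and at most [K] steps to empty the queue. *)
Lemma sweep_pass s u o d c :
  at_cfg PSweep s [::] o (behead (cells u)) (head None (cells u) :: cells d) c ->
  let: (s1, u1, o1) := sweep s u o in
  reach (K.+1 * size u)
    (at_cfg PSweep s1 [::] o1 [::] (None :: cells (catrev u1 d))) c.
Proof.
elim: u s o d c => [|x u IH] s o d c Hc /=; first exact: reach0.
case E: (sw_step s x) => [[s1 c1] o1].
have szo : size o1 <= K by have := sw_step_width s x; rewrite E.
have := IH s1 (o1 ++ o) (c1 :: d).
case: (sweep s1 u (o1 ++ o)) => [[s2 u2] o2] /= {}IH.
rewrite mulnS; apply: (reach_trans _ IH).
apply: reachS; apply: (@reach_le (size (rev o1))); first by rewrite size_rev.
rewrite -{2}(revK o1); apply: flush => //.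
case: Hc => [h1 h2 ho [w1 w2]]; rewrite (stepE h1 erefl) // /sweep_delta h2 !ffunE.
rewrite /tape_read (same_head w2) /= E /=; split=> //=.
- by rewrite queueE.
- by rewrite ffunE; exact: out_tape_id.
rewrite ffunE /=; split=> /=; first exact: same_behead.
by rewrite (same_head w1); do 2!apply: same_cons; exact: (same_behead w2).
Qed.

Lemma rewind_pass s o v d c :
  at_cfg PRewind s [::] o (cells v) (cells d) c ->
  reach (size d) (at_cfg PRewind s [::] o (cells (catrev d v)) [::]) c.
Proof.
elim: d v c => [|x d IH] v c Hc /=; first exact: reach0.
apply: reachS; apply: IH.
case: Hc => [h1 h2 ho [w1 w2]]; rewrite (stepE h1 erefl) // /sweep_delta h2 !ffunE.
rewrite /tape_read (same_head w2) /=; split=> //=.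
- by rewrite ffunE; exact: out_tape_id.
rewrite ffunE /=; split=> /=; first exact: same_cons.
exact: (same_behead w2).
Qed.

(** With [n] cells: [K.+1 * n] steps for the pass, [K.+1] for its end, [n] to rewind, and one to
    spare. *)
Definition round_cost n := K.+2 * n.+1.

Lemma round_reach s u o c :
  at_cfg PSweep s [::] o (behead (cells u)) (head None (cells u) :: [::]) c ->
  let: (s1, u1, o1) := sweep_round (s, u, o) in
  reach (round_cost (size u)) (at_cfg PRewind s1 [::] o1 (cells u1) [::]) c.
Proof.
move=> /(@sweep_pass _ _ _ [::]) /=.
have := size_sweep s u o; case: sweep => [[s1 u1] o1] /= su Hr.
case E: (sw_end s1) => [s2 o2].
have szo : size o2 <= K by have := sw_end_width s1; rewrite E.
have -> : round_cost (size u) = K.+1 * size u + (K.+1 + size u) + 1.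
  by rewrite /round_cost; lia.
rewrite -addnA; apply: (reach_trans Hr) => {Hr}c Hc.
rewrite -addnA; apply: (@reach_trans _ _
  (at_cfg PRewind s2 [::] (o2 ++ o1) (cells [::]) (cells (rev u1)))).
  apply: reachS; apply: (@reach_le (size (rev o2))); first by rewrite size_rev.
  rewrite -{2}(revK o2); apply: flush => //.
    case: Hc => [h1 h2 ho [w1 w2]]; rewrite (stepE h1 erefl) // /sweep_delta h2 !ffunE.
    rewrite /tape_read (same_head w2) /= E /=; split=> //=.
    - by rewrite queueE.
    - by rewrite ffunE; exact: out_tape_id.
    rewrite ffunE /=; split=> /=; first exact: same_None.
    exact: (same_behead w2).
move=> c1 /rewind_pass; rewrite size_rev su catrevE revK cats0 => h.
by apply: reach_le h; lia.
Qed.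

Lemma copy_pass s w v (c : cfg) :
  c.1.1 = (PCopy, s) -> c.1.2 = [::] :> seq bool ->
  same (c.2 ord0).1 [::] -> same (c.2 ord0).2 (map bitsym w) ->
  work_tape (c.2 ord_max) (cells v) [::] ->
  reach (size w).+1 (at_cfg PRewind s [::] [::]
    (cells (sw_last W :: catrev [seq sw_bit W b | b <- w] v)) [::]) c.
Proof.
elim: w v c => [|b w IH] v c h1 h2 h3 h4 [w1 w2] /=; apply: reachS.
  apply: reach0; rewrite (stepE h1 erefl) // /sweep_delta h2 !ffunE.
  rewrite {1}/tape_read (same_head h4) /=; split=> //=.
    by rewrite ffunE /=; split=> //=; exact: (same_behead h4).
  by rewrite ffunE /=; split=> /=; [exact: same_cons | exact: (same_behead w2)].
rewrite (stepE h1 erefl) // /sweep_delta h2 !ffunE.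
rewrite {1}/tape_read (same_head h4) /=; apply: IH => //=; rewrite !ffunE /=.
- exact: same_None.
- exact: (same_behead h4).
by split=> /=; [exact: same_cons | exact: (same_behead w2)].
Qed.

Lemma init_reach w :
  reach (size w).+2 (at_cfg PRewind (sw_start W) [::] [::]
    (cells (sweep_init w)) [::]) (init sweep_tm w).
Proof.
apply: reachS; rewrite /sweep_init -cats1 -catrevE.
apply: copy_pass;
  rewrite (stepE (c := init sweep_tm w) (p := PStart) (s := sw_start W) erefl erefl) //
    /sweep_delta /= ffunE //=.
by rewrite !ffunE /=; exact: same_eta.
Qed.

Definition halted_with (o : seq bool) (c : cfg) :=
  tm_halt c.1 /\ output c = o.

Lemma sweeps_reach n x y c : sweeps n x y -> sw_halt y.1.1 ->
  at_cfg PRewind x.1.1 [::] x.2 (cells x.1.2) [::] c ->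
  reach (n * (round_cost (size x.1.2)).+1).+1 (halted_with y.2) c.
Proof.
move=> H; elim: H c => {n x y} [[[s u] o]|n [[s u] o] y hs _ IH] c /= hy Hc.
  apply: reachS; apply: reach0.
  case: Hc => [h1 h2 [o1 o2] [w1 w2]]; rewrite (stepE h1 erefl) // /sweep_delta h2 !ffunE.
  rewrite {1}/tape_read (same_head w2) /= hy; split => //=.
  by rewrite /output /= ffunE /= (same_leading_bits o2) leading_bits_map.
have {}Hc : at_cfg PSweep s [::] o (behead (cells u)) (head None (cells u) :: [::]) (stp c).
  case: Hc => [h1 h2 ho [w1 w2]]; rewrite (stepE h1 erefl) // /sweep_delta h2 !ffunE.
  rewrite {1}/tape_read (same_head w2) /= (negbTE hs) /=; split=> //=.
    by rewrite ffunE; exact: out_tape_id.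
  rewrite ffunE /=; split=> /=; first exact: same_behead.
  rewrite (same_head w1); apply: same_cons; apply: same_None.
  exact: (same_behead w2).
have := round_reach Hc; have /= su := size_sweep s u o.
move: IH; rewrite /sweep_round; case: sweep su => [[s1 u1] o1] /= <-.
case: sw_end => [s2 o2] IH Hr.
rewrite mulSn addSn -addnS; apply: reachS; apply: (reach_trans Hr) => c' Hc'.
by apply: IH.
Qed.

Lemma iter_halted (c : cfg) t n : t <= n -> tm_halt (iter t stp c).1 ->
  iter n stp c = iter t stp c.
Proof.
move=> /subnK <- h; rewrite iterD; elim: (n - t) => //= m ->.
by rewrite /step h.
Qed.

(** A round takes time linear in the length of the word, so polynomially many rounds take polynomial
    time. Specifying the output by a relation [Q] avoids defining the function apart from the
    machine. *)
Theorem sweep_polytime a b (Q : seq bool -> seq bool -> Prop) :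
  (forall w, exists n s u o,
     [/\ n <= a * (size w).+1 ^ b, sweeps n (sw_start W, sweep_init w, [::]) (s, u, o),
         sw_halt s & Q w o]) ->
  exists2 f, polytime f & forall w, Q w (f w).
Proof.
move=> H; pose k := 3 + a * (1 + 3 * K.+2).
pose T (w : seq bool) := k * (size w).+1 ^ b.+1.
have HT w : exists2 o, Q w o & reach (T w) (halted_with o) (init sweep_tm w).
  have [n [s [u [o [ln run hs Qo]]]]] := H w; exists o => //.
  apply: (@reach_le ((size w).+2 + (n * (round_cost (size w).+2).+1).+1)); last first.
    apply: (reach_trans (init_reach w)) => c Hc.
    have := sweeps_reach run hs Hc.
    by rewrite /= size_rcons size_rev size_map.
  rewrite /T /k /round_cost expnS.
  have : 0 < (size w).+1 ^ b by rewrite expn_gt0.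
  move: ln; set X := _ ^ b; set Y := (size w).+1 => ln X0.
  have h1 : (K.+2 * (size w).+3).+1 <= (1 + 3 * K.+2) * Y by rewrite /Y; lia.
  have h2 : 3 * Y <= 3 * Y * X by rewrite leq_pmulr.
  have := leq_mul ln h1; set Z := n * _; set U := 1 + _.
  have -> : a * X * (U * Y) = a * U * (Y * X) by lia.
  by rewrite mulnDl; move: (a * U * (Y * X)) h2; rewrite /Y; lia.
(* The machine is run for the full time bound; steps after halting change nothing, so the output is
   a function of [w] without any choice. *)
exists (fun w => output (iter (T w) stp (init sweep_tm w))).
  exists sweep_tm, k, b.+1 => w.
  have [o _ [t tT [ht ot]]] := HT w; exists t => //.
  by rewrite (iter_halted tT ht).
move=> w; have [o Qo [t tT [ht ot]]] := HT w.
by rewrite (iter_halted tT ht) ot.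
Qed.
End Sweep.

(** * Binary digits and unique decoding *)

Lemma bitsS n : 0 < n -> bits n = odd n :: bits n./2.
Proof.
move=> n0; have up : up_log 2 n.+1 = (up_log 2 n./2.+1).+1.
  apply: up_log_eq => //; have hi : n./2.+1 <= 2 ^ up_log 2 n./2.+1 by apply: up_logP.
  have lo : 2 ^ up_log 2 n./2.+1 < n.+1.
    have [E|h] := posnP n./2; first by rewrite E up_log1.
    have := @up_log_gtn 2 n./2.+1 isT h; case: (up_log _ _) => [|e] //=.
    by rewrite expnS; lia.
  by rewrite lo expnS; lia.
rewrite /bits up /mkseq /= expn0 divn1; congr (_ :: _).
rewrite -[1]addn0 iotaDl -map_comp; apply: eq_map => i /=.
by rewrite add1n expnS divnMA divn2.
Qed.

Lemma bits0 : bits 0 = [::]. Proof. by rewrite /bits up_log1. Qed.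

Fixpoint bits_val (s : seq bool) : nat :=
  if s is b :: s1 then b + 2 * bits_val s1 else 0.

Lemma bitsK : cancel bits bits_val.
Proof.
elim/ltn_ind => n IH; have [->|n0] := posnP n; first by rewrite bits0.
rewrite bitsS //= IH; last by lia.
by rewrite mul2n odd_double_half.
Qed.

(** The most significant digit is a one; the default [true] covers zero, which is written as the
    empty word. *)
Lemma bits_last n : last true (bits n).
Proof.
elim/ltn_ind: n => n IH; have [->|n0] := posnP n; first by rewrite bits0.
rewrite bitsS //=; have := IH n./2; case: (posnP n./2) => [E _|h].
  by rewrite E bits0 /=; lia.
by rewrite [bits n./2]bitsS //= => ->; lia.
Qed.

Lemma bits_valK s : last true s -> bits (bits_val s) = s.
Proof.
elim: s => [|b s IH] /= h; first exact: bits0.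
have hs : last true s by case: (s) h.
have pos : 0 < b + 2 * bits_val s.
  case: s h hs IH => [|c s] /= h hs IH; first by rewrite h.
  have := IH hs; case: (posnP (c + 2 * bits_val s)) => [->|p _]; last by lia.
  by rewrite bits0.
rewrite bitsS //; congr (_ :: _); first by lia.
by rewrite -[RHS]IH //; congr bits; lia.
Qed.

Lemma bits_val_lt s : bits_val s < 2 ^ size s.
Proof. by elim: s => //= b s IH; rewrite expnS; lia. Qed.

(** Leading zeros are allowed here: a guessed number has to be spelled with as many digits as the
    number being read. *)
Lemma bits_valP n r : n < 2 ^ r -> exists2 s, size s = r & bits_val s = n.
Proof.
elim: r n => [|r IH] n; first by case: n => // _; exists [::].
rewrite expnS => h; have [|s <- E] := IH n./2; first by lia.
by exists (odd n :: s) => //=; lia.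
Qed.

(** Unique decoding in front of an arbitrary rest, which unlike injectivity is stable under
    concatenation. *)
Definition prefix_code T (e : T -> seq bool) :=
  forall x y u v, e x ++ u = e y ++ v -> x = y /\ u = v.

Lemma prefix_code_bit : prefix_code (fun b => [:: b]).
Proof. by move=> x y u v [-> ->]. Qed.

Lemma prefix_code_seq T (e : T -> seq bool) :
  prefix_code e -> prefix_code (enc_seq e).
Proof.
move=> He; rewrite /enc_seq; elim=> [|x s IH] [|y t] u v //=; first by case.
case; rewrite -!catA => /He [-> E].
by have [-> ->] : s = t /\ u = v by apply: IH; rewrite -!catA.
Qed.

Lemma prefix_code_nat : prefix_code enc_nat.
Proof.
move=> x y u v /(prefix_code_seq prefix_code_bit) [/(can_inj bitsK) -> ->] //.
Qed.

Lemma prefix_code_unary : prefix_code enc_unary.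
Proof.
rewrite /enc_unary; elim=> [|x IH] [|y] u v //=; first by case.
by case=> E; have [-> ->] := IH _ _ _ E.
Qed.

Lemma prefix_code_int : prefix_code enc_int.
Proof.
by move=> x y u v [s /prefix_code_nat [a ->]]; split=> //; lia.
Qed.

Lemma prefix_code_map n T (e : T -> seq bool) :
  prefix_code e -> prefix_code (fun t : n.-tuple T => flatten [seq e x | x <- t]).
Proof.
move=> He s t u v E.
suff [st ->] : tval s = tval t /\ u = v by split=> //; apply: val_inj.
move: E; have : size (tval s) = size (tval t) by rewrite !size_tuple.
move: (tval s) (tval t); elim=> [|x {}s IH] [|y {}t] //= [sz].
by rewrite -!catA => /He [-> E]; have [-> ->] := IH _ sz E.
Qed.

Lemma prefix_code_cat T1 T2 (e1 : T1 -> seq bool) (e2 : T2 -> seq bool) :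
  prefix_code e1 -> prefix_code e2 ->
  prefix_code (fun x : T1 * T2 => e1 x.1 ++ e2 x.2).
Proof.
move=> H1 H2 [x x'] [y y'] u v /=; rewrite -!catA.
by move=> /H1 [-> /H2 [-> ->]].
Qed.

Lemma prefix_code_spoly N : prefix_code (@enc_spoly N).
Proof.
exact: (prefix_code_seq (prefix_code_cat prefix_code_int
  (prefix_code_map (n := N) prefix_code_unary))).
Qed.

Lemma prefix_code_cmp : prefix_code enc_cmp.
Proof. by do 2!case; move=> u v [] // ->. Qed.

Lemma prefix_code_formula N : prefix_code (@enc_formula N).
Proof.
elim=> [c p|f IHf g IHg|f IHf g IHg|f IHf] [c' p'|f' g'|f' g'|f'] u v //=;
  rewrite -?(catA (enc_cmp _)) -?(catA (enc_formula _)) => -[].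
- by move=> /prefix_code_cmp [-> /prefix_code_spoly [-> ->]].
- by move=> /IHf [-> /IHg [-> ->]].
- by move=> /IHf [-> /IHg [-> ->]].
- by move=> /IHf [-> ->].
Qed.

(** [ETR] only asserts that some instance has the given code; injectivity identifies it with the
    instance that was written. *)
Lemma enc_etr_inj : injective enc_etr.
Proof.
move=> [N f] [N' f']; rewrite /enc_etr /= => /prefix_code_unary [E].
rewrite -{N'}E in f' *; rewrite -[enc_formula f]cats0 -[enc_formula f' in RHS]cats0.
by move=> /prefix_code_formula [->].
Qed.

(** * Writing a conjunction over all pairs of positions *)

(* The word [w] is laid out as [Some None :: rev w ++ [:: None]], from right to
   left: [None] is the left end, [Some None] the right end. *)
Definition info := option (option bool).

Definition infos (w : seq bool) : seq info :=
  Some None :: rcons (rev [seq Some (Some b) | b <- w]) None.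

(* [Some true] marks the first position of a pair, [Some false] the second. *)
Definition cell := (info * option bool)%type.

(** [SeekFst] looks for the first mark, [PutFst] and [PutSnd] place the marks on the next two cells;
    [SeekSnd] and [MoveSnd] shift the second mark by one. [PairSet] and [SndMoved] remember success
    until the end of the pass, [Emit] writes one token per pass, and [Header] the number of
    variables. *)
Inductive tag := SeekFst | PutFst | PutSnd | PairSet
               | SeekSnd | MoveSnd | SndMoved | Emit | Header | Halt.
Definition tag_code t : 'I_10 :=
  match t with
  | SeekFst => @Ordinal 10 0 isT | PutFst => @Ordinal 10 1 isT
  | PutSnd => @Ordinal 10 2 isT | PairSet => @Ordinal 10 3 isT
  | SeekSnd => @Ordinal 10 4 isT | MoveSnd => @Ordinal 10 5 isT
  | SndMoved => @Ordinal 10 6 isT | Emit => @Ordinal 10 7 isT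
  | Header => @Ordinal 10 8 isT | Halt => @Ordinal 10 9 isT
  end.
Definition tag_decode (i : 'I_10) : tag :=
  nth Halt [:: SeekFst; PutFst; PutSnd; PairSet;
               SeekSnd; MoveSnd; SndMoved; Emit; Header] i.
Lemma tag_codeK : cancel tag_code tag_decode. Proof. by case. Qed.
HB.instance Definition _ := Finite.copy tag (can_type tag_codeK).

Notation un := (map (fun x : info => (x, None : option bool))).

Section Emission.
Variables (d : nat) (T : bool -> info -> info -> formula (d + d)).

(* A piece of an encoded formula: either fixed bits, or an exponent vector that
   is nonzero at the two marked positions only. *)
Definition token := (seq bool + seq nat * seq nat)%type.

Definition mono_tokens (ce : int * (d + d).-tuple nat) : seq token :=
  [:: inl (true :: enc_int ce.1); inr (take d ce.2, drop d ce.2)].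

Fixpoint tokens (phi : formula (d + d)) : seq token :=
  match phi with
  | Atom c p => inl ([:: false; false] ++ enc_cmp c) ::
                flatten [seq mono_tokens ce | ce <- p] ++ [:: inl [:: false]]
  | And phi1 phi2 => inl [:: false; true] :: tokens phi1 ++ tokens phi2
  | Or phi1 phi2 => inl [:: true; false] :: tokens phi1 ++ tokens phi2
  | Not phi1 => inl [:: true; true] :: tokens phi1
  end.

Definition block (e1 e2 : seq nat) (mk : option bool) : seq nat :=
  match mk with
  | None => nseq d 0
  | Some true => e1
  | Some false => e2
  end.

Definition exponents e1 e2 (u : seq cell) : seq nat :=
  flatten [seq block e1 e2 c.2 | c <- rev u].

Definition emit (u : seq cell) (t : token) : seq bool :=
  match t with
  | inl s => s
  | inr e => flatten [seq enc_unary i | i <- exponents e.1 e.2 u]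
  end.

Definition emits u (ts : seq token) : seq bool :=
  flatten [seq emit u t | t <- ts].

Lemma emits_cat u s t : emits u (s ++ t) = emits u s ++ emits u t.
Proof. by rewrite /emits map_cat flatten_cat. Qed.

(** The first token is the code of [And]: in prefix notation, prepending it with the formula of the
    pair forms the conjunction with what is already written. *)
Definition pair_tokens adj x1 x2 : seq token :=
  inl [:: false; true] :: tokens (T adj x1 x2).

Definition max_tokens : nat :=
  \max_(z : bool * info * info) size (pair_tokens z.1.1 z.1.2 z.2).
Notation J := max_tokens.

Lemma size_pair_tokens adj x1 x2 : size (pair_tokens adj x1 x2) <= J.
Proof.
exact: (leq_bigmax (F := fun z : bool * info * info =>
  size (pair_tokens z.1.1 z.1.2 z.2)) (adj, x1, x2)).
Qed.

(** Adjacency, the two marked symbols, and the number of tokens still to be written; tokens are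
    written from last to first, so the next one has index [j.-1]. *)
Definition scratch := (bool * info * info * 'I_J.+1)%type.
Definition scratch0 : scratch := (false, None, None, ord0).
Definition st := (tag * scratch)%type.

(** The equation [0 = 0], on which the conjunction is built. Its code does not depend on [N]. *)
Definition true_formula N : formula N := Atom EqZero [::].

(** The first mark is put on the right end marker in the initial pass only, so the base formula is
    written exactly once. *)
Definition emit_step (s : st) (c : cell) : st * cell * seq bool :=
  let: (t, r) := s in
  let: (adj, x1, x2, j) := r in
  let: (x, mk) := c in
  match t with
  | SeekFst => if mk == Some true then ((PutFst, r), (x, None), [::])
               else (s, c, [::])
  | PutFst => ((PutSnd, (false, x, None, ord0)), (x, Some true),
               if x == Some None then enc_formula (true_formula 0) else [::])
  | PutSnd => ((PairSet, (true, x1, x, ord0)), (x, Some false), [::])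
  | SeekSnd => if mk == Some false then ((MoveSnd, r), (x, None), [::])
               else (s, c, [::])
  | MoveSnd => ((SndMoved, (false, x1, x, ord0)), (x, Some false), [::])
  | Emit =>
      (s, c, if nth (inl [::]) (pair_tokens adj x1 x2) j.-1 is inr e
             then flatten [seq enc_unary i | i <- block e.1 e.2 mk] else [::])
  | Header => (s, c, nseq d true)
  | PairSet | SndMoved | Halt => (s, c, [::])
  end.

Definition start_emit adj x1 x2 : st :=
  (Emit, (adj, x1, x2, inord (size (pair_tokens adj x1 x2)))).

(** The tag at the end of a pass tells whether a mark fell off the word. When no further pair
    exists, [[:: false]] closes the unary number of variables, whose ones [Header] then prepends.
    Tokens made of fixed bits are written here, exponent vectors during the pass. *)
Definition emit_end (s : st) : st * seq bool :=
  let: (t, (adj, x1, x2, j)) := s in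
  match t with
  | PairSet | SndMoved => (start_emit adj x1 x2, [::])
  | SeekFst | PutFst | PutSnd => ((Header, scratch0), [:: false])
  | SeekSnd | MoveSnd => ((SeekFst, scratch0), [::])
  | Emit =>
      ((if j.-1 == 0 then (SeekSnd, (false, x1, x2, ord0))
        else (Emit, (adj, x1, x2, inord j.-1))),
       if nth (inl [::]) (pair_tokens adj x1 x2) j.-1 is inl s
       then s else [::])
  | Header | Halt => ((Halt, scratch0), [::])
  end.

Definition emitter : sweeper :=
  @Sweeper st cell (PutFst, scratch0) (None, None) (Some None, None)
    (fun b => (Some (Some b), None)) emit_step emit_end
    (fun s => s.1 == Halt).

Notation snap := (snapshot emitter).
Lemma sweep_init_emitter w : sweep_init emitter w = un (infos w).
Proof. by rewrite /sweep_init /infos /= map_rcons map_rev -map_comp. Qed.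

Definition sweeps_le n (x y : snap) := exists2 m, m <= n & sweeps m x y.

Lemma sweeps_le_trans n1 n2 x y z :
  sweeps_le n1 x y -> sweeps_le n2 y z -> sweeps_le (n1 + n2) x z.
Proof.
move=> [m1 l1 s1] [m2 l2 s2]; exists (m1 + m2); first exact: leq_add.
exact: sweeps_trans s1 s2.
Qed.

Lemma sweeps_le_leq n m (x y : snap) : n <= m -> sweeps_le n x y -> sweeps_le m x y.
Proof. by move=> nm [k kn s]; exists k => //; apply: leq_trans nm. Qed.

Lemma sweeps_le1 (x y : snap) : x.1.1.1 != Halt -> sweep_round x = y ->
  sweeps_le 1 x y.
Proof. by move=> h <-; exists 1 => //; apply: sweeps1. Qed.

Definition unmarked mk (u : seq cell) := all (fun c : cell => c.2 != mk) u.

Lemma unmarked_un b v : unmarked (Some b) (un v).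
Proof. by apply/allP => c /mapP [x _ ->]. Qed.

Notation sweepE := (@sweep emitter).

Lemma sweep_skip mk t r a v o :
  unmarked (Some mk) a -> (t, mk) = (SeekFst, true) \/ (t, mk) = (SeekSnd, false) ->
  sweepE (t, r) (a ++ v) o =
  let: (s, u, o1) := sweepE (t, r) v o in (s, a ++ u, o1).
Proof.
case: r => [[[adj x1] x2] j].
move=> ua E; elim: a ua => [_|[x m] a IH] /=; first by case: sweep => [[]].
case/andP=> /negbTE hm /IH {IH} IH.
case: E IH hm => -[-> ->] IH hm; rewrite hm /= IH;
  by case: sweep => [[]].
Qed.

Lemma sweep_id t r v o : t = PairSet \/ t = SndMoved ->
  sweepE (t, r) v o = ((t, r), v, o).
Proof.
case: r => [[[adj x1] x2] j] E.
by elim: v => //= -[x m] v IH; case: E IH => -> /= ->.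
Qed.

Lemma sweep_Header v o :
  sweepE (Header, scratch0) v o = ((Header, scratch0), v, nseq (size v * d) true ++ o).
Proof.
elim: v o => //= -[x m] v IH o.
by rewrite IH catA -nseqD addnC mulSn addnC.
Qed.

Lemma sweep_Emit adj x1 x2 (j : 'I_J.+1) v o :
  sweepE (Emit, (adj, x1, x2, j)) v o =
  ((Emit, (adj, x1, x2, j)), v,
   if nth (inl [::]) (pair_tokens adj x1 x2) j.-1 is inr e
   then emit v (inr e) ++ o else o).
Proof.
elim: v o => [|[x m] v IH] o /=; first by case: nth.
rewrite IH; case: nth => // e.
by rewrite /exponents rev_cons map_rcons -cats1 flatten_cat map_cat flatten_cat /= cats0 catA.
Qed.

Lemma round_Emit adj x1 x2 (j : nat) v o :
  let ts := pair_tokens adj x1 x2 in j < size ts ->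
  @sweep_round emitter ((Emit, (adj, x1, x2, inord j.+1)), v, o) =
  ((if j == 0 then (SeekSnd, (false, x1, x2, ord0))
    else (Emit, (adj, x1, x2, inord j))), v,
   emit v (nth (inl [::]) ts j) ++ o).
Proof.
move=> ts hj; have ht := size_pair_tokens adj x1 x2.
rewrite /sweep_round sweep_Emit /= inordK //=; last by rewrite ltnS (leq_trans hj).
by rewrite -/ts; case: nth => [s|e] /=; rewrite ?cats0.
Qed.

Lemma emit_rounds adj x1 x2 v o (j : nat) :
  let ts := pair_tokens adj x1 x2 in 0 < j -> j <= size ts ->
  sweeps_le j ((Emit, (adj, x1, x2, inord j)), v, o)
    ((SeekSnd, (false, x1, x2, ord0)), v, emits v (take j ts) ++ o).
Proof.
move=> ts; case: j => // j _; elim: j o => [|j IH] o hj.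
  apply: sweeps_le1 => //; rewrite round_Emit //= /emits.
  by rewrite take0.
apply: (@sweeps_le_trans 1 j.+1 _
  ((Emit, (adj, x1, x2, inord j.+1)), v, emit v (nth (inl [::]) ts j.+1) ++ o)).
  by apply: sweeps_le1 => //; rewrite round_Emit.
rewrite (take_nth (inl [::])) // -cats1 emits_cat -catA.
by rewrite {2}/emits /= cats0; apply: IH; apply: ltnW.
Qed.

Lemma emit_pair_rounds adj x1 x2 v o :
  sweeps_le J (start_emit adj x1 x2, v, o)
    ((SeekSnd, (false, x1, x2, ord0)), v, emits v (pair_tokens adj x1 x2) ++ o).
Proof.
have [//|//|m hm hs] := @emit_rounds adj x1 x2 v o (size (pair_tokens adj x1 x2)).
rewrite take_size in hs; exists m => //.
exact: leq_trans (size_pair_tokens adj x1 x2).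
Qed.

Definition pair_mark a x1 b x2 c : seq cell :=
  un a ++ (x1, Some true) :: un b ++ (x2, Some false) :: un c.

Lemma round_SeekSnd a x1 b x2 c r y o :
  @sweep_round emitter ((SeekSnd, (false, x1, r, ord0)), pair_mark a x1 b x2 (y :: c), o) =
  (start_emit false x1 y, pair_mark a x1 (rcons b x2) y c, o).
Proof.
rewrite /sweep_round /pair_mark (@sweep_skip false) ?unmarked_un; [|by []|by right].
rewrite /= (@sweep_skip false) ?unmarked_un; [|by []|by right].
by rewrite /= sweep_id /=; [rewrite map_rcons cat_rcons | right].
Qed.

Lemma round_SeekSnd_last a x1 b x2 r o :
  @sweep_round emitter ((SeekSnd, (false, x1, r, ord0)), pair_mark a x1 b x2 [::], o) =
  ((SeekFst, scratch0), un a ++ (x1, Some true) :: un (rcons b x2), o).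
Proof.
rewrite /sweep_round /pair_mark (@sweep_skip false) ?unmarked_un; [|by []|by right].
rewrite /= (@sweep_skip false) ?unmarked_un; [|by []|by right].
by rewrite /= map_rcons -cats1.
Qed.

Definition put_fst a x1 c o : snap :=
  if c is x2 :: c' then (start_emit true x1 x2, pair_mark a x1 [::] x2 c', o)
  else ((Header, scratch0), un a ++ [:: (x1, Some true)], false :: o).

Lemma round_SeekFst a x0 x1 c o : x1 != Some None ->
  @sweep_round emitter ((SeekFst, scratch0), un a ++ (x0, Some true) :: un (x1 :: c), o) =
  put_fst (rcons a x0) x1 c o.
Proof.
move=> h; rewrite /sweep_round (@sweep_skip true) ?unmarked_un; [|by []|by left].
rewrite /= (negbTE h) /put_fst /pair_mark map_rcons cat_rcons.
case: c => [|x2 c] //=; rewrite sweep_id /= ?cat_rcons //.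
by left.
Qed.

Lemma round_PutFst c :
  @sweep_round emitter ((PutFst, scratch0), un (Some None :: c), [::]) =
  put_fst [::] (Some None) c (enc_formula (true_formula 0)).
Proof.
rewrite /sweep_round /put_fst /pair_mark.
case: c => [|x2 c] /=; rewrite ?sweep_id /= ?cats0 //.
by left.
Qed.
End Emission.

(** * Meaning of the formula written for a marked pair *)

Section Instance.
Variables (d n : nat).
Notation N := (n * d).

(** If [u] has [n] cells, the exponents have length [n * d] and the default of [insubd] is not
    taken. *)
Definition inst_mono (u : seq cell) (ce : int * (d + d).-tuple nat) :
    int * N.-tuple nat :=
  (ce.1, insubd (nseq_tuple N 0) (exponents d (take d ce.2) (drop d ce.2) u)).

Fixpoint inst (u : seq cell) (phi : formula (d + d)) : formula N :=
  match phi with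
  | Atom c p => Atom c [seq inst_mono u ce | ce <- p]
  | And phi1 phi2 => And (inst u phi1) (inst u phi2)
  | Or phi1 phi2 => Or (inst u phi1) (inst u phi2)
  | Not phi1 => Not (inst u phi1)
  end.

Lemma size_exponents e1 e2 u : size e1 = d -> size e2 = d ->
  size (exponents d e1 e2 u) = size u * d.
Proof.
move=> h1 h2; rewrite /exponents size_flatten /shape -map_comp.
rewrite (eq_map (g := fun=> d)); last by move=> [x [[]|]] //=; rewrite size_nseq.
by elim/last_ind: u => //= u x IH; rewrite rev_rcons /= IH size_rcons mulSn.
Qed.

Lemma inst_monoE u ce : size u = n ->
  (inst_mono u ce).2 = exponents d (take d ce.2) (drop d ce.2) u :> seq nat.
Proof.
move=> hu; rewrite /= val_insubd size_exponents ?hu ?eqxx //.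
  by rewrite size_takel // size_tuple leq_addr.
by rewrite size_drop size_tuple addnK.
Qed.

Lemma emits_tokens u phi : size u = n ->
  emits d u (tokens phi) = enc_formula (inst u phi).
Proof.
move=> hu; elim: phi => [c p|f IHf g IHg|f IHf g IHg|f IHf] /=.
- rewrite {1}/emits /= -/(emits d u _) emits_cat /enc_spoly /enc_seq catA -catA.
  congr [:: _, _ & _ ++ (_ ++ _)]; elim: p => //= ce p IH.
  rewrite {1}/emits /= -/(emits d u _) IH inst_monoE //.
  by rewrite !catA.
- by rewrite /emits /= -/(emits d u _) emits_cat IHf IHg.
- by rewrite /emits /= -/(emits d u _) emits_cat IHf IHg.
- by rewrite /emits /= -/(emits d u _) IHf.
Qed.

Variable R : realType.
Local Open Scope ring_scope.

Definition vec (s : 'I_d -> R) : seq R := [seq s i | i <- enum 'I_d].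

Lemma size_vec s : size (vec s) = d.
Proof. by rewrite size_map size_enum_ord. Qed.

(* Positions are numbered from right to left, variables from left to right. *)
Definition env (B : seq ('I_d -> R)) : 'I_N -> R :=
  fun i => nth 0 (flatten [seq vec s | s <- rev B]) i.

Definition join (s1 s2 : 'I_d -> R) (i : 'I_(d + d)) : R :=
  match split i with inl j => s1 j | inr j => s2 j end.

Definition monomial (xs : seq R) (es : seq nat) : R :=
  \prod_(z <- zip xs es) z.1 ^+ z.2.

Lemma monomial_cat xs ys es fs : size xs = size es ->
  monomial (xs ++ ys) (es ++ fs) = monomial xs es * monomial ys fs.
Proof. by move=> h; rewrite /monomial zip_cat // big_cat. Qed.

Lemma monomial_nseq0 xs m : monomial xs (nseq m 0) = 1.
Proof.
elim: xs m => [|x xs IH] [|m]; rewrite /monomial ?big_nil //= big_cons /=.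
by rewrite mul1r; apply: IH.
Qed.

Lemma prod_monomial m xs (e : m.-tuple nat) : size xs = m ->
  \prod_(i < m) nth 0 xs i ^+ tnth e i = monomial xs e.
Proof.
move=> hx; rewrite /monomial (big_nth (0, 0%N)) size_zip hx size_tuple minnn big_mkord.
by apply: eq_bigr => i _; rewrite nth_zip ?hx ?size_tuple //= (tnth_nth 0%N).
Qed.

Lemma size_vecs B : size (flatten [seq vec s | s <- B]) = (size B * d)%N.
Proof. by elim: B => //= s B IH; rewrite size_cat size_vec IH mulSn. Qed.

Lemma monomial_exponents (B : seq ('I_d -> R)) (u : seq cell) e1 e2 :
  size e1 = d -> size e2 = d -> size B = size u ->
  monomial (flatten [seq vec s | s <- rev B]) (exponents d e1 e2 u) =
  \prod_(z <- zip B u) monomial (vec z.1) (block d e1 e2 z.2.2).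
Proof.
move=> h1 h2; elim: B u => [|s B IH] [|c u] //= => [_|[hu]].
  by rewrite /monomial !big_nil.
rewrite big_cons /= -IH // /exponents !rev_cons !map_rcons -!cats1 !flatten_cat /= !cats0.
rewrite monomial_cat; first by rewrite mulrC.
by rewrite size_vecs -[flatten _ in RHS]/(exponents d e1 e2 u) size_exponents // size_rev hu.
Qed.

Section Marked.
Variables (a b c : seq info) (x1 x2 : info).
Variables (Ba Bb Bc : seq ('I_d -> R)) (s1 s2 : 'I_d -> R).
Hypotheses (ha : size Ba = size a) (hb : size Bb = size b)
           (hc : size Bc = size c).
Let u := pair_mark a x1 b x2 c.
Let B := Ba ++ s1 :: Bb ++ s2 :: Bc.
Hypothesis hn : size B = n.

Let hu : size u = n.
Proof. by rewrite -hn !(size_cat, size_map, size_rev) /= !size_cat /= !size_map ha hb hc. Qed.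

Lemma join_vec (i : 'I_(d + d)) : join s1 s2 i = nth 0 (vec s1 ++ vec s2) i.
Proof.
rewrite /join nth_cat size_vec; case: splitP => j ->.
  by rewrite (nth_map j) ?size_enum_ord // nth_ord_enum.
by rewrite addKn (nth_map j) ?size_enum_ord // nth_ord_enum.
Qed.

(** Exponents vanish at unmarked positions, whose variables contribute a factor 1; the marked
    positions contribute powers of the entries of [s1] and [s2]. *)
Lemma eval_inst (p : spoly (d + d)) :
  eval_spoly (env B) [seq inst_mono u ce | ce <- p] =
  eval_spoly (join s1 s2) p.
Proof.
rewrite /eval_spoly big_map; apply: eq_bigr => ce _; congr (_ * _).
have e1 : size (take d ce.2) = d by rewrite size_takel // size_tuple leq_addr.
have e2 : size (drop d ce.2) = d by rewrite size_drop size_tuple addnK.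
rewrite prod_monomial ?size_vecs ?size_rev ?hn // inst_monoE ?hu //.
rewrite monomial_exponents ?hu //.
under [RHS]eq_bigr do rewrite join_vec.
rewrite prod_monomial ?size_cat ?size_vec // -[tval ce.2 in RHS](cat_take_drop d).
rewrite monomial_cat ?size_vec // /u /B /pair_mark.
have un1 (v : seq info) Bv : size Bv = size v ->
    \prod_(z <- zip Bv (un v)) monomial (vec z.1)
       (block d (take d ce.2) (drop d ce.2) z.2.2) = 1.
  elim: Bv v => [|s Bv IH] [|x v] //= => [_|[h]]; first by rewrite big_nil.
  by rewrite big_cons IH //= monomial_nseq0 mul1r.
rewrite zip_cat ?size_map // big_cat /= un1 // big_cons /= mul1r.
by rewrite zip_cat ?size_map // big_cat /= un1 // big_cons /= mul1r un1 // mulr1.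
Qed.

Lemma holds_inst phi : holds (env B) (inst u phi) <-> holds (join s1 s2) phi.
Proof.
elim: phi => [cm p|f IHf g IHg|f IHf g IHg|f IHf] /=; last 3 first.
- by rewrite IHf IHg.
- by rewrite IHf IHg.
- by rewrite IHf.
by rewrite -eval_inst.
Qed.
End Marked.
End Instance.

(** * Looping over the pairs, and the resulting reduction *)

Section Pairs.
Variables (X Y : Type) (P : bool -> X -> X -> Y -> Y -> Prop).

Fixpoint pairs_with adj x1 (s1 : Y) (l : seq (X * Y)) : Prop :=
  if l is (x2, s2) :: l' then P adj x1 x2 s1 s2 /\ pairs_with false x1 s1 l'
  else True.

(* The boolean tells whether the two positions are adjacent. *)
Fixpoint all_pairs (l : seq (X * Y)) : Prop :=
  if l is (x1, s1) :: l' then pairs_with true x1 s1 l' /\ all_pairs l'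
  else True.
End Pairs.

Section Reduction.
Variables (R : realType) (d : nat) (T : bool -> info -> info -> formula (d + d)).
Notation J := (max_tokens T).
Notation vector := ('I_d -> R).

Definition pair_holds adj x1 x2 (s1 s2 : vector) :=
  holds (join s1 s2) (T adj x1 x2).

Section Length.
Variable n : nat.
Let s0 : vector := fun=> 0%R.

(** Invariant of the loops: what has been written so far is a complete formula, and [P] is its
    meaning. *)
Definition encodes (o : seq bool) (P : seq vector -> Prop) :=
  exists2 phi : formula (n * d), o = enc_formula phi &
    forall B, size B = n -> holds (env B) phi <-> P B.

Lemma encodes_iff o (P Q : seq vector -> Prop) :
  (forall B, size B = n -> P B <-> Q B) -> encodes o P -> encodes o Q.
Proof.
by move=> PQ [phi -> h]; exists phi => // B hB; rewrite h // PQ.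
Qed.

Lemma encodes_pair a x1 b x2 c adj o (P : seq vector -> Prop) :
  size (pair_mark a x1 b x2 c) = n -> encodes o P ->
  encodes (emits d (pair_mark a x1 b x2 c) (pair_tokens T adj x1 x2) ++ o)
    (fun B => pair_holds adj x1 x2 (nth s0 B (size a))
                (nth s0 B (size a + size b).+1) /\ P B).
Proof.
move=> hu [phi -> hphi].
exists (And (inst n (pair_mark a x1 b x2 c) (T adj x1 x2)) phi) => /=.
  by rewrite -emits_tokens // /emits /= catA.
move=> B hB; rewrite hphi //.
suff -> : holds (env B) (inst n (pair_mark a x1 b x2 c) (T adj x1 x2)) <->
  pair_holds adj x1 x2 (nth s0 B (size a)) (nth s0 B (size a + size b).+1) by [].
move: hu; rewrite /pair_mark size_cat /= size_cat /= !size_map => hu.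
pose D := drop (size a).+1 B.
have EB : B = take (size a) B ++ nth s0 B (size a) :: take (size b) D ++
    nth s0 B (size a + size b).+1 :: drop (size b).+1 D.
  rewrite -{1}(cat_take_drop (size a) B) (drop_nth s0); last by lia.
  rewrite -/D -{1}(cat_take_drop (size b) D) (drop_nth s0 (n := size b)); last first.
    by rewrite size_drop; lia.
  by rewrite {2}/D nth_drop addSn.
rewrite {1}EB; apply: holds_inst; rewrite -?EB //.
- by rewrite size_takel; lia.
- by rewrite size_takel // size_drop; lia.
- by rewrite !size_drop; lia.
Qed.

(** Each position of the second mark costs at most [J] rounds of emission, and one round to shift
    the mark or drop it at the end. *)
Lemma inner_loop a x1 b x2 c adj o (P : seq vector -> Prop) :
  size (pair_mark a x1 b x2 c) = n -> encodes o P ->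
  exists2 o', sweeps_le ((size c).+1 * J.+1)
     (start_emit T adj x1 x2, pair_mark a x1 b x2 c, o)
     ((SeekFst, scratch0 T), un a ++ (x1, Some true) :: un (b ++ x2 :: c), o') &
   encodes o' (fun B => pairs_with pair_holds adj x1 (nth s0 B (size a))
       (zip (x2 :: c) (drop (size a + size b).+1 B)) /\ P B).
Proof.
elim: c b x2 adj o P => [|y c IH] b x2 adj o P hu hP.
  exists (emits d (pair_mark a x1 b x2 [::]) (pair_tokens T adj x1 x2) ++ o).
    apply: (@sweeps_le_leq _ _ (J + 1)); first by rewrite /=; lia.
    apply: sweeps_le_trans (emit_pair_rounds adj x1 x2 _ o) _.
    by apply: sweeps_le1 => //; rewrite round_SeekSnd_last cats1.
  apply: encodes_iff (encodes_pair adj hu hP) => B hB.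
  rewrite (drop_nth s0) /=; last first.
    by move: hu; rewrite /pair_mark size_cat /= size_cat /= !size_map; lia.
  by case: drop => [|? ?] /=; tauto.
have hu' : size (pair_mark a x1 (rcons b x2) y c) = n.
  rewrite -hu /pair_mark !(size_cat, size_map) /= !(size_cat, size_map) /=.
  by rewrite size_rcons; lia.
have [o' run ho'] := IH (rcons b x2) y false _ _ hu' (encodes_pair adj hu hP).
exists o'.
  apply: (@sweeps_le_leq _ _ (J + (1 + (size c).+1 * J.+1))); first by rewrite /=; lia.
  apply: sweeps_le_trans (emit_pair_rounds adj x1 x2 _ o) _.
  rewrite cat_rcons in run; apply: sweeps_le_trans run.
  by apply: sweeps_le1 => //; rewrite round_SeekSnd.
apply: encodes_iff ho' => B hB.
rewrite [drop (size a + size b).+1 B](drop_nth s0) /=; last first.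
  by move: hu; rewrite /pair_mark size_cat /= size_cat /= !size_map; lia.
by rewrite size_rcons addnS; tauto.
Qed.

(** There are [(size c).+1] positions for the first mark, each with at most [size c] pairs and one
    round to advance. The hypothesis on [c] keeps the base formula from being written again. *)
Lemma outer_loop a x1 c o (P : seq vector -> Prop) :
  Some None \notin c -> size a + (size c).+1 = n -> encodes o P ->
  exists u o', [/\ size u = n, sweeps_le ((size c).+1 * (size c * J.+1).+1)
     (put_fst T a x1 c o) ((Header, scratch0 T), u, false :: o') &
   encodes o' (fun B => all_pairs pair_holds (zip (x1 :: c) (drop (size a) B)) /\ P B)].
Proof.
elim: c a x1 o P => [|x2 c IH] a x1 o P hc hn hP.
  exists (un a ++ [:: (x1, Some true)]), o; split=> /=.
  - by rewrite size_cat size_map.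
  - by exists 0 => //; apply: Sweeps0.
  apply: encodes_iff hP => B hB; case: drop => [|s [|s' D]] /=; tauto.
have hu : size (pair_mark a x1 [::] x2 c) = n.
  by rewrite -hn /pair_mark size_cat /= !size_map.
have [o1 run1 h1] := inner_loop true hu hP.
move: hc; rewrite inE negb_or eq_sym => /andP [h2 hc].
have hn' : size (rcons a x1) + (size c).+1 = n by rewrite size_rcons -hn /=; lia.
have [u [o' [su run2 h']]] := IH (rcons a x1) x2 _ _ hc hn' h1.
exists u, o'; split=> //.
  have [m1 l1 r1] := run1; have [m2 l2 r2] := run2.
  exists (m1 + (1 + m2)).
    apply: leq_trans (leq_add l1 (leq_add (leqnn 1) l2)) _ => /=.
    set k := size c; set K := J.+1.
    suff -> : k.+2 * (k.+1 * K).+1 = k.+1 * K + (1 + k.+1 * (k * K).+1) + k.+1 * K.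
      exact: leq_addr.
    by clearbody k K; lia.
  apply: (sweeps_trans r1); apply: sweeps_trans r2.
  by rewrite -(@round_SeekFst _ T a x1 x2 c o1 h2); apply: sweeps1.
apply: encodes_iff h' => B hB.
rewrite [drop (size a) B](drop_nth s0) /=; last by rewrite hB -hn; lia.
by rewrite size_rcons addn0; tauto.
Qed.
End Length.

Lemma infos_notin w : (Some None : info) \notin rcons (rev [seq Some (Some b) | b <- w]) None.
Proof.
rewrite mem_rcons inE /= mem_rev; apply/mapP => -[b _] //.
Qed.

Lemma size_infos w : size (infos w) = (size w).+2.
Proof. by rewrite /= size_rcons size_rev size_map. Qed.

Lemma env_surj n (x : 'I_(n * d) -> R) :
  exists2 B : seq vector, size B = n & env B = x.
Proof.
pose xs := [seq x i | i <- enum 'I_(n * d)].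
have sxs : size xs = n * d by rewrite size_map size_enum_ord.
pose ss := reshape (nseq n d) xs.
have sh : shape ss = nseq n d by apply: reshapeKl; rewrite sumn_nseq sxs mulnC.
exists (rev [seq (fun j : 'I_d => nth 0%R s j) | s <- ss]).
  by rewrite size_rev size_map size_reshape size_nseq.
apply: funext => i; rewrite /env revK -map_comp map_id_in; last first.
  move=> s hs /=; have : size s \in shape ss by apply: map_f.
  rewrite sh mem_nseq => /andP[_ /eqP hsd].
  apply: (@eq_from_nth _ 0%R); rewrite size_vec // => j hj.
  by rewrite (nth_map (Ordinal hj)) ?size_enum_ord // nth_enum_ord.
rewrite reshapeKr ?sumn_nseq ?sxs 1?mulnC // (nth_map i) ?size_enum_ord //.
by rewrite nth_ord_enum.
Qed.

Theorem pair_formula_polytime :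
  exists2 f, polytime f & forall w, ETR R (f w) <->
    exists2 B : seq vector, size B = size (infos w) &
      all_pairs pair_holds (zip (infos w) B).
Proof.
(* The number of rounds is quadratic: two positions vary, and each pair costs a bounded number of
   rounds. One more round puts the first mark, and one writes the header. *)
apply: (@sweep_polytime (emitter T) (3 + 2 * (2 * J.+1).+1) 2
  (fun w o => ETR R o <-> exists2 B : seq vector, size B = size (infos w) &
     all_pairs pair_holds (zip (infos w) B))) => w.
set n := size (infos w).
have base : encodes n (enc_formula (true_formula 0)) (fun=> True).
  exists (true_formula (n * d)) => // B hB /=.
  by rewrite /eval_spoly big_nil.
have [|u [o [su [m lm run] [phi Eo ho]]]] :=
    outer_loop (a := [::]) (Some None) (infos_notin w) _ base.
  by rewrite /n size_infos size_rcons size_rev size_map.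
exists (1 + (m + 1)), (Halt, scratch0 T), u, (enc_etr (ETRInstance phi)); split=> //.
- move: lm; rewrite size_rcons size_rev size_map.
  set k := size w; set K := J.+1; clearbody k K; rewrite expnS expn1; nia.
- rewrite sweep_init_emitter; apply: (sweeps_trans (sweeps1 _)) => //.
  rewrite round_PutFst; apply: (sweeps_trans run).
  suff <- : @sweep_round (emitter T) ((Header, scratch0 T), u, false :: o) =
      ((Halt, scratch0 T), u, enc_etr (ETRInstance phi)) by apply: sweeps1.
  by rewrite /sweep_round sweep_Header /= /enc_etr /enc_unary /= su -catA -Eo.
split=> [[I /enc_etr_inj <- [x hx]]|[B hB hp]].
  have [B hB EB] := env_surj x; exists B => //.
  by move: hx; rewrite -EB /= ho // => -[]; rewrite drop0.
exists (ETRInstance phi) => //; exists (env B) => /=.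
by rewrite ho // drop0; split.
Qed.
End Reduction.

(** * Definable relations *)

Section Definable.
Variables (R : realType) (N : nat).
Local Open Scope ring_scope.
Implicit Types (f g : ('I_N -> R) -> R) (P Q : ('I_N -> R) -> Prop).

(** Mere existence is enough: only finitely many formulas, one for each choice of symbols and
    adjacency, are extracted in the end. *)
Definition polyfun f := exists p : spoly N, forall x, eval_spoly x p = f x.
Definition definable P := exists phi : formula N, forall x, holds x phi <-> P x.

Lemma polyfun_ext f g : (forall x, f x = g x) -> polyfun f -> polyfun g.
Proof. by move=> fg [p hp]; exists p => x; rewrite hp. Qed.

Lemma polyfun_int (z : int) : polyfun (fun=> z%:~R).
Proof.
exists [:: (z, nseq_tuple N 0%N)] => x.
rewrite /eval_spoly big_seq1 /= big1 ?mulr1 // => i _.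
by rewrite (tnth_nth 0%N) nth_nseq; case: ifP; rewrite expr0.
Qed.

Lemma polyfun_nat (n : nat) : polyfun (fun=> n%:R).
Proof. exact: (polyfun_int n%:Z). Qed.

Lemma polyfun_var i : polyfun (fun x => x i).
Proof.
exists [:: (1, [tuple (j == i : nat) | j < N])] => x.
rewrite /eval_spoly big_seq1 /= mul1r (bigD1 i) //= tnth_mktuple eqxx expr1.
by rewrite big1 ?mulr1 // => j /negbTE ji; rewrite tnth_mktuple ji expr0.
Qed.

Lemma polyfunD f g : polyfun f -> polyfun g -> polyfun (fun x => f x + g x).
Proof.
by move=> [p hp] [q hq]; exists (p ++ q) => x; rewrite -hp -hq /eval_spoly big_cat.
Qed.

Lemma polyfunM f g : polyfun f -> polyfun g -> polyfun (fun x => f x * g x).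
Proof.
move=> [p hp] [q hq].
exists [seq (c.1 * e.1, [tuple (tnth c.2 j + tnth e.2 j)%N | j < N]) | c <- p, e <- q] => x.
rewrite -hp -hq /eval_spoly big_allpairs_dep mulr_suml; apply: eq_bigr => c _.
rewrite mulr_sumr; apply: eq_bigr => e _ /=.
rewrite intrM mulrACA -big_split /=; congr (_ * _); apply: eq_bigr => j _.
by rewrite tnth_mktuple exprD.
Qed.

Lemma polyfunN f : polyfun f -> polyfun (fun x => - f x).
Proof.
move=> hf; apply: polyfun_ext (polyfunM (polyfun_int (-1)) hf) => x.
by rewrite mulN1r.
Qed.

Lemma polyfun_sum (I : finType) (f : I -> ('I_N -> R) -> R) :
  (forall i, polyfun (f i)) -> polyfun (fun x => \sum_i f i x).
Proof.
move=> hf; elim: (index_enum I) => [|i r IH].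
  by apply: polyfun_ext (polyfun_nat 0) => x; rewrite big_nil.
by apply: polyfun_ext (polyfunD (hf i) IH) => x; rewrite big_cons.
Qed.

Lemma definable_ext P Q : (forall x, P x <-> Q x) -> definable P -> definable Q.
Proof. by move=> PQ [p hp]; exists p => x; rewrite hp PQ. Qed.

Lemma definable_eq f g : polyfun f -> polyfun g -> definable (fun x => f x = g x).
Proof.
move=> hf hg; have [p hp] := polyfunD hf (polyfunN hg).
exists (Atom EqZero p) => x /=; rewrite hp; split=> [/eqP|->]; last by rewrite subrr.
by rewrite subr_eq0 => /eqP.
Qed.

Lemma definable_and P Q : definable P -> definable Q -> definable (fun x => P x /\ Q x).
Proof. by move=> [p hp] [q hq]; exists (And p q) => x /=; rewrite hp hq. Qed.

Lemma definable_or P Q : definable P -> definable Q -> definable (fun x => P x \/ Q x).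
Proof. by move=> [p hp] [q hq]; exists (Or p q) => x /=; rewrite hp hq. Qed.

Lemma definable_not P : definable P -> definable (fun x => ~ P x).
Proof. by move=> [p hp]; exists (Not p) => x /=; rewrite hp. Qed.

(** Covers the conditions on fixed modes and symbols, which do not depend on the variables. *)
Lemma definable_const (A : Prop) : definable (fun=> A).
Proof.
have [HA|HA] := EM A.
  by apply: definable_ext (definable_eq (polyfun_nat 0) (polyfun_nat 0)).
by apply: definable_ext (definable_not (definable_eq (polyfun_nat 0) (polyfun_nat 0))).
Qed.

Lemma definable_imply P Q : definable P -> definable Q -> definable (fun x => P x -> Q x).
Proof.
move=> hP hQ; apply: definable_ext (definable_or (definable_not hP) hQ) => x.
by split=> [[] // nP /nP|h] //; have [HP|] := EM (P x); [right; apply: h | left].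
Qed.

Lemma definable_and3 P Q S : definable P -> definable Q -> definable S ->
  definable (fun x => [/\ P x, Q x & S x]).
Proof.
move=> hP hQ hS; apply: definable_ext (definable_and hP (definable_and hQ hS)) => x.
by split=> [[? []]|[]].
Qed.

Lemma definable_forall (I : finType) (P : I -> ('I_N -> R) -> Prop) :
  (forall i, definable (P i)) -> definable (fun x => forall i, P i x).
Proof.
move=> hP; suff h (r : seq I) : definable (fun x => forall i, i \in r -> P i x).
  apply: definable_ext (h (enum I)) => x.
  by split=> H i; [apply: H; rewrite mem_enum | move=> _; apply: H].
elim: r => [|i r IH].
  by apply: definable_ext (definable_const True) => x; split.
apply: definable_ext (definable_and (hP i) IH) => x.
split=> [[h1 h2] j|H].
  by rewrite inE => /orP [/eqP -> //|]; apply: h2.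
by split=> [|j jr]; apply: H; rewrite inE ?eqxx // jr orbT.
Qed.

Lemma definable_exists (I : finType) (P : I -> ('I_N -> R) -> Prop) :
  (forall i, definable (P i)) -> definable (fun x => exists i, P i x).
Proof.
move=> hP; have hN i := definable_not (hP i).
apply: definable_ext (definable_not (definable_forall hN)) => x.
by split=> [/existsNP [i /contrapT]|[i Pi] H]; [exists i | apply: (H i)].
Qed.
End Definable.

(** * An automaton with real registers *)

Inductive target := Tm | Tn | Tq | Tnum | Tden.
Definition target_code t : 'I_5 :=
  match t with
  | Tm => @Ordinal 5 0 isT | Tn => @Ordinal 5 1 isT | Tq => @Ordinal 5 2 isT
  | Tnum => @Ordinal 5 3 isT | Tden => @Ordinal 5 4 isT
  end.
Definition target_decode (i : 'I_5) : target := nth Tm [:: Tm; Tn; Tq; Tnum; Tden] i.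
Lemma target_codeK : cancel target_code target_decode. Proof. by case. Qed.
HB.instance Definition _ := Finite.copy target (can_type target_codeK).

(** In order: the dimensions, the indices of the current equation, row and column, the sum
    accumulated so far, the numerator with its guess, the number being read with its guess, and the
    weight of the next digit. *)
Inductive reg := Rm | Rn | Rq | Rl | Ri | Rj | Racc | Rnum | Rgnum | Rcur | Rgcur | Rpow.
Definition reg_code r : 'I_12 :=
  match r with
  | Rm => @Ordinal 12 0 isT | Rn => @Ordinal 12 1 isT | Rq => @Ordinal 12 2 isT
  | Rl => @Ordinal 12 3 isT | Ri => @Ordinal 12 4 isT | Rj => @Ordinal 12 5 isT
  | Racc => @Ordinal 12 6 isT | Rnum => @Ordinal 12 7 isT
  | Rgnum => @Ordinal 12 8 isT | Rcur => @Ordinal 12 9 isT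
  | Rgcur => @Ordinal 12 10 isT | Rpow => @Ordinal 12 11 isT
  end.
Definition reg_decode (i : 'I_12) : reg :=
  nth Rm [:: Rm; Rn; Rq; Rl; Ri; Rj; Racc; Rnum; Rgnum; Rcur; Rgcur; Rpow] i.
Lemma reg_codeK : cancel reg_code reg_decode. Proof. by case. Qed.
HB.instance Definition _ := Finite.copy reg (can_type reg_codeK).

(* [None]: an entry or the end of the input is expected.  [Some (t, sg, c)]: a
   natural number is being read into [t], [sg] being the sign of the current
   rational; [c] is [None] when a digit is expected, and otherwise tells whether
   the number may stop, i.e. whether its last digit is not a zero. *)
Definition mode := option (target * bool * option bool).

Section Automaton.
Variable R : realType.
Local Open Scope ring_scope.
Implicit Types (s : reg -> R) (w : seq bool).

Definition set_number s (c g p : R) : reg -> R := fun r =>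
  match r with Rcur => c | Rgcur => g | Rpow => p | _ => s r end.

(** With [n = 0] the rows hold no entry that could make [Ri] advance, so the right-hand side comes
    at once. *)
Definition at_rhs s : Prop := s Ri = s Rm \/ s Rn = 0.

Definition signed (sg : bool) (x : R) : R := if sg then - x else x.

(* Coprimality of the numerator and the denominator is certified by guessed
   Bezout coefficients. *)
Definition reduced sg s : Prop :=
  [/\ s Rcur <> 0, (sg -> s Rnum <> 0) &
      (s Rnum = 0 /\ s Rcur = 1) \/ s Rgcur * s Rnum - s Rgnum * s Rcur = 1].

(** The rational is [signed sg (s Rnum) / s Rcur]; multiplying by [s Rcur], nonzero by [reduced],
    keeps the conditions polynomial. Such an equation determines the new accumulator, whence
    [s' Racc] on the right-hand side. *)
Definition stop_number (dot : R) t sg (q : mode) s s' : Prop :=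
  match t with
  | Tm => q = Some (Tn, false, Some true) /\
      forall r, s' r = match r with Rm => s Rcur | _ => set_number s 0 0 1 r end
  | Tn => q = Some (Tq, false, Some true) /\
      forall r, s' r = match r with Rn => s Rcur | _ => set_number s 0 0 1 r end
  | Tq => q = None /\
      forall r, s' r = match r with Rq => s Rcur | _ => set_number s 0 0 1 r end
  | Tnum => q = Some (Tden, sg, Some true) /\
      forall r, s' r = match r with Rnum => s Rcur | Rgnum => s Rgcur
                       | _ => set_number s 0 0 1 r end
  | Tden => [/\ q = None, reduced sg s &
      (at_rhs s /\ s Racc * s Rcur = signed sg (s Rnum) /\
       forall r, s' r = match r with Rl => s Rl + 1
         | Ri | Rj | Racc | Rnum | Rgnum => 0 | _ => set_number s 0 0 1 r end) \/
      (~ at_rhs s /\ (s' Racc - s Racc) * s Rcur = signed sg (s Rnum) * dot /\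
       ((s Rj + 1 = s Rn /\
         forall r, s' r = match r with Racc => s' Racc | Ri => s Ri + 1
           | Rj | Rnum | Rgnum => 0 | _ => set_number s 0 0 1 r end) \/
        (s Rj + 1 <> s Rn /\
         forall r, s' r = match r with Racc => s' Racc | Rj => s Rj + 1
           | Rnum | Rgnum => 0 | _ => set_number s 0 0 1 r end)))]
  end.

(** Along with every digit a bit [g] of a Bezout coefficient is guessed, so that the coefficient
    needs no input of its own. *)
Definition read (dot : R) (b : bool) (q q' : mode) s s' : Prop :=
  match q with
  | None => [/\ s Rl <> s Rq, q' = Some (Tnum, b, Some true) & forall r, s' r = s r]
  | Some (t, sg, None) => q' = Some (t, sg, Some b) /\
      exists g : bool, forall r, s' r =
        set_number s (s Rcur + b%:R * s Rpow) (s Rgcur + g%:R * s Rpow)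
          (2%:R * s Rpow) r
  | Some (t, sg, Some ok) =>
      if b then q' = Some (t, sg, None) /\ forall r, s' r = s r
      else ok /\ stop_number dot t sg q' s s'
  end.

Variables (k : nat) (F G : R -> 'I_k -> R).

Definition dot s : R := \sum_c F (s Ri) c * G (s Rj) c.

Fixpoint accepts (q : mode) s w : Prop :=
  if w is b :: w' then
    exists q' s', read (dot s) b q q' s s' /\ accepts q' s' w'
  else q = None /\ s Rl = s Rq.

Definition accepts_stop t sg s w : Prop :=
  exists q s', stop_number (dot s) t sg q s s' /\ accepts q s' w.

Definition number_code (bs : seq bool) := enc_seq (fun b => [:: b]) bs.

(** A digit takes two letters, a continuation bit and its value, so the induction is on the length
    of [w]. The registers are arbitrary so that the hypothesis applies after the first digit. *)
Lemma accepts_digits t sg ok s w :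
  accepts (Some (t, sg, Some ok)) s w <->
  exists bs gs w', [/\ w = number_code bs ++ w', size gs = size bs, last ok bs &
    accepts_stop t sg (set_number s (s Rcur + (bits_val bs)%:R * s Rpow)
      (s Rgcur + (bits_val gs)%:R * s Rpow) (2 ^+ size bs * s Rpow)) w'].
Proof.
have [m] := ubnP (size w); elim: m w s ok => // m IH [|b w] s ok /= hw.
  by split=> [[]|[[|b bs] [gs [w' []]]]].
case: b => /=; last first.
  split=> [[q [s' [[ok1 st] ac]]]|].
    exists [::], [::], w; split=> //; exists q, s'; split=> //.
    suff -> : set_number s (s Rcur + 0%:R * s Rpow) (s Rgcur + 0%:R * s Rpow)
      (2 ^+ 0 * s Rpow) = s by [].
    by apply: funext => -[] //=; rewrite ?mul0r ?addr0 ?mul1r.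
  move=> [[|b bs] [gs [w' [//]]]] [->] /size0nil -> /= ok1.
  suff -> : set_number s (s Rcur + 0%:R * s Rpow) (s Rgcur + 0%:R * s Rpow)
      (2 ^+ 0 * s Rpow) = s by move=> [q [s' [st ac]]]; exists q, s'.
  by apply: funext => -[] //=; rewrite ?mul0r ?addr0 ?mul1r.
case: w hw => [|b w] hw.
  split=> [[q [s' [[-> hs]]]] []//|].
  by move=> [[|b bs] [gs [w' [//]]]].
pose s1 g := set_number s (s Rcur + b%:R * s Rpow) (s Rgcur + g%:R * s Rpow)
          (2%:R * s Rpow).
have E1 bs (g : bool) gs : size gs = size bs ->
  set_number (s1 g) (s1 g Rcur + (bits_val bs)%:R * s1 g Rpow)
      (s1 g Rgcur + (bits_val gs)%:R * s1 g Rpow) (2 ^+ size bs * s1 g Rpow) =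
  set_number s (s Rcur + (bits_val (b :: bs))%:R * s Rpow)
      (s Rgcur + (bits_val (g :: gs))%:R * s Rpow) (2 ^+ size (b :: bs) * s Rpow).
  by move=> sz; apply: funext => -[] //=; rewrite ?natrD ?natrM ?exprS; ring.
split.
  move=> [q [s' [[-> hs]]]] /= [q2 [s2 [[-> [g hg]]]]].
  have {hs} E : s' = s by apply: funext.
  rewrite {}E in hg *.
  have {hg} -> : s2 = s1 g by apply: funext.
  move=> /IH -/(_ (ltnW hw)) [bs [gs [w' [-> sz lb st]]]].
  exists (b :: bs), (g :: gs), w'; split=> //=; first by rewrite sz.
  by rewrite -E1.
move=> [[|b' bs] [[|g gs] [w' [//]]]] [<- Ew] [sz] /= lb; subst w.
rewrite -[(_ + _)%N]/(bits_val (b :: bs)) -[(_ + _)%N]/(bits_val (g :: gs)).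
rewrite -[(size bs).+1]/(size (b :: bs)) -E1 // => st.
exists (Some (t, sg, None)), s; split=> //=; exists (Some (t, sg, Some b)), (s1 g).
split; first by split=> //; exists g.
have hw' : (size (number_code bs ++ w') < m)%N
  by move: hw; rewrite /number_code /enc_seq /=; lia.
by apply/(IH _ _ _ hw'); exists bs, gs, w'.
Qed.

(** The final test on the last digit excludes leading zeros, so the digits read are exactly
    [bits x]; the guess [g] ranges over all numbers of that many digits. *)
Lemma accepts_number t sg s w :
  s Rcur = 0 -> s Rgcur = 0 -> s Rpow = 1 ->
  accepts (Some (t, sg, Some true)) s w <->
  exists x g w', [/\ w = enc_nat x ++ w', (g < 2 ^ size (bits x))%N &
    accepts_stop t sg (set_number s x%:R g%:R (2 ^+ size (bits x))) w'].
Proof.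
move=> h1 h2 h3; rewrite accepts_digits h1 h2 h3; split.
  move=> [bs [gs [w' [-> sz lb]]]]; rewrite !add0r !mulr1 => st.
  exists (bits_val bs), (bits_val gs), w'; rewrite /enc_nat bits_valK //.
  by split=> //; rewrite -sz bits_val_lt.
move=> [x [g [w' [-> /bits_valP [gs sz <-] st]]]].
exists (bits x), gs, w'; rewrite !add0r !mulr1 bitsK; split=> //.
exact: bits_last.
Qed.

Definition regs (m n q l i j acc : R) : reg -> R := fun r =>
  match r with
  | Rm => m | Rn => n | Rq => q | Rl => l | Ri => i | Rj => j | Racc => acc
  | Rpow => 1
  | _ => 0
  end.

Lemma accepts_header w :
  accepts (Some (Tm, false, Some true)) (regs 0 0 0 0 0 0 0) w <->
  exists m n q w', w = enc_nat m ++ enc_nat n ++ enc_nat q ++ w' /\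
    accepts None (regs m%:R n%:R q%:R 0 0 0 0) w'.
Proof.
rewrite accepts_number //; split.
  move=> [m [g1 [w1 [-> _ [p1 [s1 [[-> /= e1] H]]]]]]].
  have {e1} E1 : s1 = regs m%:R 0 0 0 0 0 0 by apply: funext => r; rewrite e1; case: r.
  move: H; rewrite {}E1 accepts_number //.
  move=> [n [g2 [w2 [-> _ [p2 [s2 [[-> /= e2] H]]]]]]].
  have {e2} E2 : s2 = regs m%:R n%:R 0 0 0 0 0 by apply: funext => r; rewrite e2; case: r.
  move: H; rewrite {}E2 accepts_number //.
  move=> [q [g3 [w3 [-> _ [p3 [s3 [[-> /= e3] H]]]]]]].
  have {e3} E3 : s3 = regs m%:R n%:R q%:R 0 0 0 0 by apply: funext => r; rewrite e3; case: r.
  by exists m, n, q, w3; rewrite -E3.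
move=> [m [n [q [w' [-> H]]]]].
(* Guesses made in the header are never checked, so 0 serves. *)
exists m, 0%N, (enc_nat n ++ enc_nat q ++ w'); split=> //; first by rewrite expn_gt0.
exists (Some (Tn, false, Some true)), (regs m%:R 0 0 0 0 0 0).
split; first by split=> // -[].
apply/accepts_number => //; exists n, 0%N, (enc_nat q ++ w').
split=> //; first by rewrite expn_gt0.
exists (Some (Tq, false, Some true)), (regs m%:R n%:R 0 0 0 0 0).
split; first by split=> // -[].
apply/accepts_number => //; exists q, 0%N, w'.
split=> //; first by rewrite expn_gt0.
by exists None, (regs m%:R n%:R q%:R 0 0 0 0); split=> //; split=> // -[].
Qed.
End Automaton.

(** * Bezout certificates and reduced fractions *)

(** The bounds let [u] and [v] be guessed within the digits of [d] and [a]. No such [u] exists for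
    [a = 0], where coprimality forces [d = 1]. *)
Lemma coprime_bezout a d : 0 < d -> coprime a d ->
  a = 0 /\ d = 1 \/
  exists u v, [/\ u <= d, v <= a & u * a = v * d + 1].
Proof.
move=> d0 cop; have [a0|a0] := posnP a.
  by left; split=> //; move: cop; rewrite a0 /coprime gcd0n => /eqP.
right; have [v va /dvdnP [u Eu]] := @Bezoutl a d a0.
move: Eu; rewrite (eqP cop) => Eu.
by exists u, v; split; [nia | apply: ltnW | lia].
Qed.

Lemma coprime_of_bezout a d u v : u * a = v * d + 1 -> coprime a d.
Proof.
move=> E; rewrite /coprime -dvdn1; have <- : u * a - v * d = 1 by lia.
by rewrite dvdn_sub // dvdn_mull // ?dvdn_gcdl ?dvdn_gcdr.
Qed.

Section Ratio.
Variable R : realType.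
Local Open Scope ring_scope.

Lemma ratr_signed (r : rat) :
  ratr r = signed (numq r < 0) (`|numq r|%N%:R : R) / `|denq r|%N%:R.
Proof.
rewrite /ratr; congr (_ / _).
  rewrite /signed; case: ltrP => h; last by rewrite -[in LHS](gez0_abs h) pmulrn.
  by rewrite -[in LHS](opprK (numq r)) -(ltz0_abs h) rmorphN pmulrn.
by rewrite -[in LHS](gez0_abs (denq_ge0 r)) pmulrn.
Qed.

(** The condition on the sign excludes a negative zero, since the sign bit stands for
    [numq r < 0]. *)
Lemma ratio_rat (sg : bool) (a d : nat) : (0 < d)%N -> coprime a d ->
  (sg -> (0 < a)%N) ->
  exists r : rat, [/\ (numq r < 0) = sg, `|numq r|%N = a & `|denq r|%N = d].
Proof.
move=> d0 cop hs; pose z : int := if sg then - a%:Z else a%:Z.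
have az : `|z|%N = a by rewrite /z; case: (sg) => //; lia.
have P : (0 < (z, d%:Z).2) && coprime `|(z, d%:Z).1| `|(z, d%:Z).2|.
  by rewrite /= az cop andbT; lia.
exists (Rat P); rewrite /numq /denq /=; split=> //.
by rewrite /z; case: (sg) hs => [/(_ isT)|_]; lia.
Qed.

Lemma enc_ratE (r : rat) w :
  enc_rat r ++ w = (numq r < 0) :: enc_nat `|numq r| ++ enc_nat `|denq r| ++ w.
Proof. by rewrite /enc_rat /enc_int /= -catA. Qed.
End Ratio.

(** One pattern for the three nested loops of the parser, over entries, rows and equations: each
    step decodes one item, checks [C] and adds [h] to a running sum. *)
Lemma loopP (R : nmodType) (T : Type) (e : T -> seq bool) (n : nat) (h : nat -> T -> R)
    (C : nat -> T -> Prop) (P : nat -> R -> seq bool -> Prop) :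
  (forall i x w, i < n -> P i x w <->
     exists r w', [/\ w = e r ++ w', C i r & P i.+1 (x + h i r)%R w']) ->
  forall x w, P 0 x w <->
    exists (rs : 'I_n -> T) w',
      [/\ w = flatten [seq e (rs i) | i <- enum 'I_n] ++ w',
          forall i : 'I_n, C i (rs i) & P n (x + \sum_(i < n) h i (rs i))%R w'].
Proof.
elim: n h C P => [|n IH] h C P HP x w.
  have rs0 : 'I_0 -> T by case.
  split=> [Pw|[rs [w' []]]].
    exists rs0, w; split; last by rewrite big_ord0 addr0.
      by rewrite (_ : enum _ = [::]) //; apply: size0nil; rewrite size_enum_ord.
    by case.
  rewrite (_ : enum _ = [::]) //; last by apply: size0nil; rewrite size_enum_ord.
  by move=> -> _; rewrite big_ord0 addr0.
rewrite HP //.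
have {}IH := IH (fun i => h i.+1) (fun i => C i.+1) (fun i => P i.+1)
  (fun i x w hi => HP i.+1 x w hi).
split=> [[r [w1 [-> Cr /IH [rs [w' [-> Crs Pw]]]]]]|[rs [w' [-> Crs Pw]]]].
  exists (fun i => if unlift ord0 i is Some j then rs j else r), w'; split.
  - rewrite enum_ordSl /= unlift_none -map_comp -catA; congr (_ ++ (flatten _ ++ _)).
    by apply: eq_map => i /=; rewrite liftK.
  - by move=> i; case: unliftP => [j ->|->] //; apply: Crs.
  - rewrite big_ord_recl unlift_none addrA.
    by under eq_bigr do rewrite liftK lift0.
exists (rs ord0), (flatten [seq e (rs (lift ord0 i)) | i <- enum 'I_n] ++ w').
split; [by rewrite enum_ordSl /= -map_comp catA | exact: (Crs ord0) |].
apply/IH; exists (fun i => rs (lift ord0 i)), w'; split=> //.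
  by move=> i; have := Crs (lift ord0 i); rewrite lift0.
by move: Pw; rewrite big_ord_recl addrA; under eq_bigr do rewrite lift0.
Qed.

(** * The language accepted by the automaton *)

Section Parse.
Variables (R : realType) (k : nat) (F G : R -> 'I_k -> R).
Local Open Scope ring_scope.
Notation accepts := (accepts F G).

Definition entry (i j : nat) : R := \sum_c F i%:R c * G j%:R c.

(** Only the spelling is treated here; the arithmetic of the entry remains in [accepts_stop]. The
    condition [l <> q] means that more input must follow. *)
Lemma accepts_rat_shape (m n q l i j : nat) (acc : R) w : l <> q ->
  let s := regs m%:R n%:R q%:R l%:R i%:R j%:R acc in
  accepts None s w <->
  exists (sg : bool) (a v d u : nat) w',
   [/\ w = sg :: enc_nat a ++ enc_nat d ++ w',
       (v < 2 ^ size (bits a))%N, (u < 2 ^ size (bits d))%N &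
       accepts_stop F G Tden sg
        (fun r => match r with
                  | Rnum => a%:R | Rgnum => v%:R
                  | _ => set_number s d%:R u%:R (2 ^+ size (bits d)) r end) w'].
Proof.
move=> lq s; case: w => [|sg w].
  by split=> [[_ /eqP]|[? [? [? [? [? [? []]]]]]] //]; rewrite eqr_nat => /eqP.
have lq' : s Rl <> s Rq by move/eqP; rewrite eqr_nat => /eqP.
pose s1 (a v : nat) : reg -> R := fun r => match r with
                  | Rnum => a%:R | Rgnum => v%:R | _ => s r end.
split=> [[p1 [t1 [[_ -> e1]]]]|].
  have {e1} -> : t1 = s by apply: funext.
  rewrite -/(accepts _ _ _) accepts_number //.
  move=> [a [v [w1 [-> hv [p2 [t2 [[-> /= e2] H]]]]]]].
  have {e2} E2 : t2 = s1 a v by apply: funext => r; rewrite e2; case: r.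
  move: H; rewrite {}E2 accepts_number //.
  move=> [d [u [w2 [-> hu H]]]].
  exists sg, a, v, d, u, w2; split=> //.
  rewrite (_ : (fun r => _) = set_number (s1 a v) d%:R u%:R (2 ^+ size (bits d))) //.
  by apply: funext => -[].
move=> [sg' [a [v [d [u [w' [[-> ->] hv hu H]]]]]]].
exists (Some (Tnum, sg', Some true)), s; split=> //.
apply/accepts_number => //; exists a, v, (enc_nat d ++ w'); split=> //.
exists (Some (Tden, sg', Some true)), (s1 a v); split; first by split=> // -[].
apply/accepts_number => //; exists d, u, w'; split=> //.
move: H; rewrite (_ : (fun r => _) = set_number (s1 a v) d%:R u%:R (2 ^+ size (bits d))) //.
by apply: funext => -[].
Qed.

(** The guesses certify that the fraction is in lowest terms, hence the code of a rational;
    conversely, Bezout coefficients supply guesses for any rational. *)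
Lemma accepts_entry (m n q l i j : nat) (acc : R) w : l <> q ->
  accepts None (regs m%:R n%:R q%:R l%:R i%:R j%:R acc) w <->
  exists r w', w = enc_rat r ++ w' /\
    if (i == m) || (n == 0)%N then
      ratr r = acc /\ accepts None (regs m%:R n%:R q%:R l.+1%:R 0 0 0) w'
    else
      accepts None (if j.+1 == n
        then regs m%:R n%:R q%:R l%:R i.+1%:R 0 (acc + ratr r * entry i j)
        else regs m%:R n%:R q%:R l%:R i%:R j.+1%:R (acc + ratr r * entry i j)) w'.
Proof.
move=> lq; rewrite accepts_rat_shape //.
set s := regs _ _ _ _ _ _ _.
pose S (a v d u : nat) : reg -> R := fun r => match r with
                  | Rnum => a%:R | Rgnum => v%:R
                  | _ => set_number s d%:R u%:R (2 ^+ size (bits d)) r end.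
have rhsP a v d u : at_rhs (S a v d u) <-> (i == m) || (n == 0)%N.
  rewrite /at_rhs /S /=; split=> [[/eqP|/eqP]|/orP [/eqP ->|/eqP ->]].
  - by rewrite eqr_nat => ->.
  - by rewrite pnatr_eq0 => ->; rewrite orbT.
  - by left.
  - by right.
have colP a v d u : (S a v d u Rj + 1 = S a v d u Rn) <-> (j.+1 == n).
  rewrite /S /=; split=> [/eqP|/eqP <-]; last by rewrite natr1.
  by rewrite natr1 eqr_nat.
split.
  move=> [sg [a [v [d [u [w' [-> hv hu [q' [s' [[-> [/= d0 a0 red] st] H]]]]]]]]]].
  have {}d0 : (0 < d)%N by rewrite lt0n; apply/eqP => E; apply: d0; rewrite E.
  have {}a0 : sg -> (0 < a)%N.
    by move=> /a0 h; rewrite lt0n; apply/eqP => E; apply: h; rewrite E.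
  have cop : coprime a d.
    case: red => [[/eqP]|/eqP].
      rewrite pnatr_eq0 => /eqP -> /eqP; rewrite -[1]/(1%:R) eqr_nat => /eqP ->.
      by [].
    rewrite subr_eq -!natrM nat1r eqr_nat => /eqP E.
    by apply: (@coprime_of_bezout a d u v); rewrite E addn1.
  have [r [r1 r2 r3]] := ratio_rat d0 cop a0.
  have dR : (d%:R : R) != 0 by rewrite pnatr_eq0 -lt0n.
  have rr : ratr r = signed sg a%:R / d%:R :> R by rewrite ratr_signed r1 r2 r3.
  exists r, w'; rewrite r1 r2 r3 -catA; split=> //.
  case: st => [[/rhsP -> [e1 e2]]|[/rhsP /negP/negbTE -> [e1 e2]]].
    split; first by rewrite rr -e1 /S /= mulfK.
    rewrite (_ : regs _ _ _ _ _ _ _ = s') //; apply: funext => x.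
    by rewrite e2; case: x; rewrite /S //= natr1.
  have acc' : s' Racc = acc + ratr r * entry i j.
    move: e1; rewrite /S /= rr => e1; apply: (mulIf dR).
    rewrite mulrDl mulrAC divfK //; move/eqP: e1; rewrite mulrBl subr_eq addrC.
    by move=> /eqP ->; rewrite addrC.
  case: e2 => [[/(colP a v d u) -> e2]|[/(colP a v d u) /negP/negbTE -> e2]];
   by rewrite (_ : regs _ _ _ _ _ _ _ = s') //; apply: funext => x;
      rewrite e2; case: x; rewrite -?acc' /S //= natr1.
move=> [r [w' [-> H]]].
set sg := (numq r < 0); set a := `|numq r|%N; set d := `|denq r|%N.
have d0 : (0 < d)%N by rewrite /d absz_gt0 denq_neq0.
have cop : coprime a d by apply: coprime_num_den.
have a0 : sg -> (0 < a)%N by rewrite /sg /a; lia.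
have dR : (d%:R : R) != 0 by rewrite pnatr_eq0 -lt0n.
have rr : ratr r = signed sg a%:R / d%:R :> R by rewrite ratr_signed.
(* Since [u <= d] and [v <= a] below, this bound makes the guesses fit in the available digits. *)
have szb x : (x < 2 ^ size (bits x))%N by rewrite -{1}(bitsK x) bits_val_lt.
have [u [v [hu hv bez]]] : exists u v, [/\ (u <= d)%N, (v <= a)%N &
    a = 0%N /\ d = 1%N \/ (u * a = v * d + 1)%N].
  case: (coprime_bezout d0 cop) => [h|[u [v [h1 h2 h3]]]].
    by exists 0%N, 0%N; split=> //; left.
  by exists u, v; split=> //; right.
exists sg, a, v, d, u, w'; rewrite enc_ratE; split=> //.
- exact: leq_ltn_trans (szb a).
- exact: leq_ltn_trans (szb d).
have red : reduced sg (S a v d u).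
  split; rewrite /S /=.
  - exact/eqP.
  - by move=> /a0; rewrite lt0n => h; apply/eqP; rewrite pnatr_eq0.
  - case: bez => [[-> ->]|bez]; [by left | right].
    by rewrite -!natrM bez natrD addrC addKr.
exists None.
move: H; case: ifP => hr H.
  case: H => accE H; exists (regs m%:R n%:R q%:R l.+1%:R 0 0 0); split=> //.
  split=> //; left; split; first by apply/(rhsP a v d u).
  split; first by rewrite /= -accE rr divfK.
  by move=> x; case: x; rewrite //= natr1.
move: H; case: ifP => hj H.
  exists (regs m%:R n%:R q%:R l%:R i.+1%:R 0 (acc + ratr r * entry i j)); split=> //.
  split=> //; right; split; first by move=> /(rhsP a v d u); rewrite hr.
  split; first by rewrite /= addrC addKr rr mulrAC divfK.
  left; split; first by apply/(colP a v d u).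
  by move=> x; case: x; rewrite //= natr1.
exists (regs m%:R n%:R q%:R l%:R i%:R j.+1%:R (acc + ratr r * entry i j)); split=> //.
split=> //; right; split; first by move=> /(rhsP a v d u); rewrite hr.
split; first by rewrite /= addrC addKr rr mulrAC divfK.
right; split; first by move=> /(colP a v d u); rewrite hj.
by move=> x; case: x; rewrite //= natr1.
Qed.
End Parse.

Section Parse.
Variables (R : realType) (k : nat) (F G : R -> 'I_k -> R).
Local Open Scope ring_scope.
Notation accepts := (accepts F G).
Notation entry := (entry F G).

Lemma enum0 : enum 'I_0 = [::].
Proof. by apply: size0nil; rewrite size_enum_ord. Qed.

Lemma accepts_row (m n q l i : nat) (acc : R) w :
  l <> q -> (0 < n)%N -> (i < m)%N ->
  accepts None (regs m%:R n%:R q%:R l%:R i%:R 0 acc) w <->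
  exists (a : 'I_n -> rat) w',
    w = flatten [seq enc_rat (a j) | j <- enum 'I_n] ++ w' /\
    accepts None (regs m%:R n%:R q%:R l%:R i.+1%:R 0
      (acc + \sum_(j < n) ratr (a j) * entry i j)) w'.
Proof.
move=> lq n0 im.
(* After the last column the automaton is already at the start of row [i.+1], so the invariant
   changes form at [j == n]. *)
pose P (j : nat) x w := accepts None (if j == n
     then regs m%:R n%:R q%:R l%:R i.+1%:R 0 x
     else regs m%:R n%:R q%:R l%:R i%:R j%:R x) w.
have := @loopP R rat enc_rat n (fun j r => ratr r * entry i j) (fun _ _ => True) P.
have P0 x v : P 0%N x v = accepts None (regs m%:R n%:R q%:R l%:R i%:R 0 x) v.
  by rewrite /P eq_sym (gtn_eqF n0).
have Pn x v : P n x v = accepts None (regs m%:R n%:R q%:R l%:R i.+1%:R 0 x) v.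
  by rewrite /P eqxx.
move=> H; rewrite -P0 H {H}.
  under eq_exists do under eq_exists do rewrite Pn.
  by split=> [[a [w' [-> _ H]]]|[a [w' [-> H]]]]; exists a, w'.
move=> j x {}w jn; rewrite /P (ltn_eqF jn) accepts_entry //.
rewrite (ltn_eqF im) eqn0Ngt n0 /=.
split=> [[r [w' [-> H]]]|[r [w' [-> _ H]]]]; exists r, w'; split=> //.
Qed.

Lemma accepts_equation (m n q l : nat) w : l <> q ->
  accepts None (regs m%:R n%:R q%:R l%:R 0 0 0) w <->
  exists (ab : ('I_m -> 'I_n -> rat) * rat) w',
    [/\ w = (flatten [seq flatten [seq enc_rat (ab.1 i j) | j <- enum 'I_n]
                  | i <- enum 'I_m] ++ enc_rat ab.2) ++ w',
        \sum_(i < m) \sum_(j < n) ratr (ab.1 i j) * entry i j = ratr ab.2 &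
        accepts None (regs m%:R n%:R q%:R l.+1%:R 0 0 0) w'].
Proof.
move=> lq; have [n0|n0] := posnP n.
  (* The zeros are turned into casts of natural numbers to match [accepts_entry]. *)
  subst n; rewrite -[in regs _ _ _ _ 0 0 0](mulr0n 1) accepts_entry // orbT.
  have nil (a : 'I_m -> 'I_0 -> rat) :
      flatten [seq flatten [seq enc_rat (a i j) | j <- enum 'I_0] | i <- enum 'I_m] = [::].
    by elim: (enum 'I_m) => //= i e ->; rewrite enum0.
  have sum0 (a : 'I_m -> 'I_0 -> rat) :
      \sum_(i < m) \sum_(j < 0) ratr (a i j) * entry i j = 0 :> R.
    by rewrite big1 // => i _; rewrite big_ord0.
  split=> [[r [w' [-> [rE H]]]]|[[a r] [w' [-> rE H]]]].
    by exists (fun _ _ => 0, r), w'; split=> //=; rewrite ?nil ?sum0 ?rE.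
  by move: rE => /= rE; exists r, w'; rewrite nil -rE sum0.
have rows x w0 : accepts None (regs m%:R n%:R q%:R l%:R 0 0 x) w0 <->
    exists (a : 'I_m -> 'I_n -> rat) w',
      [/\ w0 = flatten [seq flatten [seq enc_rat (a i j) | j <- enum 'I_n]
                  | i <- enum 'I_m] ++ w', forall i : 'I_m, True &
      accepts None (regs m%:R n%:R q%:R l%:R m%:R 0
        (x + \sum_(i < m) \sum_(j < n) ratr (a i j) * entry i j)) w'].
  pose e (a : 'I_n -> rat) := flatten [seq enc_rat (a j) | j <- enum 'I_n].
  refine (@loopP R ('I_n -> rat) e m
    (fun i a => \sum_(j < n) ratr (a j) * entry i j) (fun _ _ => True)
    (fun i x => accepts None (regs m%:R n%:R q%:R l%:R i%:R 0 x)) _ x w0).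
  move=> i {}x {}w0 im; rewrite accepts_row //.
  by split=> [[a [w' [-> H]]]|[a [w' [-> _ H]]]]; exists a, w'.
rewrite rows; split=> [[a [w' [-> _]]]|[[a r] [w' [-> rE H]]]].
  rewrite add0r -[in regs _ _ _ _ _ 0 _](mulr0n 1) accepts_entry // eqxx /=.
  move=> [r [w2 [-> [rE H]]]]; exists (a, r), w2; split=> /=; last exact: H.
    by rewrite -[RHS](catA _ (enc_rat r)).
  by rewrite rE.
exists a, (enc_rat r ++ w'); rewrite catA; split=> //.
rewrite add0r -[in regs _ _ _ _ _ 0 _](mulr0n 1) accepts_entry // eqxx /=.
by exists r, w'; rewrite rE.
Qed.

Definition arm_equations (I : arm_instance) : Prop :=
  forall l, \sum_(i < arm_m I) \sum_(j < arm_n I) ratr (arm_A l i j) * entry i j =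
            ratr (arm_b l) :> R.

Lemma accepts_arm w :
  accepts (Some (Tm, false, Some true)) (regs 0 0 0 0 0 0 0) w <->
  exists2 I, w = enc_arm I & arm_equations I.
Proof.
rewrite accepts_header.
have eqs m n q w0 : accepts None (regs m%:R n%:R q%:R 0 0 0 0) w0 <->
    exists (ab : 'I_q -> ('I_m -> 'I_n -> rat) * rat) w',
    [/\ w0 = flatten [seq flatten [seq flatten [seq enc_rat ((ab l).1 i j)
              | j <- enum 'I_n] | i <- enum 'I_m] ++ enc_rat (ab l).2
              | l <- enum 'I_q] ++ w',
        forall l : 'I_q, \sum_(i < m) \sum_(j < n) ratr ((ab l).1 i j) * entry i j
                    = ratr (ab l).2 :> R &
        accepts None (regs m%:R n%:R q%:R q%:R 0 0 0) w'].
  pose e (ab : ('I_m -> 'I_n -> rat) * rat) := flatten [seq flatten [seq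
    enc_rat (ab.1 i j) | j <- enum 'I_n] | i <- enum 'I_m] ++ enc_rat ab.2.
  (* The increment is 0: each equation starts a fresh sum, and its validity is recorded in the
     condition [C]. *)
  refine (@loopP R (('I_m -> 'I_n -> rat) * rat) e q (fun _ _ => 0)
    (fun _ ab => \sum_(i < m) \sum_(j < n) ratr (ab.1 i j) * entry i j = ratr ab.2)
    (fun l _ => accepts None (regs m%:R n%:R q%:R l%:R 0 0 0)) _ 0 w0).
  by move=> l _ {}w0 lq; apply: accepts_equation => E; rewrite E ltnn in lq.
split=> [[m [n [q [w' [-> /eqs [ab [w1 [-> hab hw1]]]]]]]]|[I -> hI]].
  (* Once [Rl] equals [Rq] no letter can be read, so the input ends here. *)
  have {hw1} -> : w1 = [::] by case: w1 hw1 => //= b w1 [p [s [[[]]]]].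
  pose A l := \matrix_(i, j) (ab l).1 i j.
  exists (@ARMInstance m n q A (fun l => (ab l).2)); last first.
    move=> l /=; rewrite -hab; apply: eq_bigr => i _; apply: eq_bigr => j _.
    by rewrite mxE.
  rewrite /enc_arm /= cats0; do 3!congr (_ ++ _); congr flatten.
  apply: eq_map => l; congr (flatten _ ++ _); apply: eq_map => i; congr flatten.
  by apply: eq_map => j; rewrite mxE.
exists (arm_m I), (arm_n I), (arm_q I); eexists; split; first by rewrite /enc_arm.
by apply/eqs; exists (fun l => (fun i j => arm_A l i j, arm_b l)), [::]; rewrite cats0.
Qed.
End Parse.

(** * Runs as assignments of state vectors *)

Ltac prove_polyfun :=
  repeat first
    [ solve [auto]
    | apply: polyfunD | apply: polyfunM | apply: polyfunN
    | exact: polyfun_nat | exact: (polyfun_nat _ _ 0)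
    | exact: (polyfun_nat _ _ 1) ].

Ltac prove_definable :=
  repeat first
    [ apply: definable_const | apply: definable_and | apply: definable_and3
    | apply: definable_or | apply: definable_not | apply: definable_imply
    | apply: definable_eq; solve [prove_polyfun]
    | apply: definable_exists => ?
    | apply: definable_forall => -[] /=; apply: definable_eq; solve [prove_polyfun] ].

Section ReadDefinable.
Variables (R : realType) (N : nat).
Variables (s s' : ('I_N -> R) -> reg -> R) (dot : ('I_N -> R) -> R).
Hypotheses (hs : forall r, polyfun (fun x => s x r))
           (hs' : forall r, polyfun (fun x => s' x r))
           (hdot : polyfun dot).

Lemma definable_stop t sg q :
  definable (fun x => stop_number (dot x) t sg q (s x) (s' x)).
Proof.
case: t; rewrite /stop_number /reduced /at_rhs /signed; case: sg; prove_definable.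
Qed.

Lemma definable_read b q q' :
  definable (fun x => read (dot x) b q q' (s x) (s' x)).
Proof.
case: q => [[[t sg] [ok|]]|]; rewrite /read; last 2 first.
- prove_definable.
- prove_definable.
case: b; first by prove_definable.
apply: definable_and; first exact: definable_const.
exact: definable_stop.
Qed.
End ReadDefinable.

Section Runs.
Variables (R : realType) (k : nat).
Local Open Scope ring_scope.

(* A state vector holds the mode, the registers, and the vectors stored by the
   guessed memories [F] and [G] at the addresses in [Ri] and [Rj]. *)
Definition var : finType := (option reg + ('I_k + 'I_k))%type.
Definition vmode : var := inl None.
Definition vreg r : var := inl (Some r).
Definition vfst c : var := inr (inl c).
Definition vsnd c : var := inr (inr c).

Notation d := #|var|.
Notation vector := ('I_d -> R).
Implicit Types (a b s : vector).

Definition value s (v : var) : R := s (enum_rank v).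
Definition registers s (r : reg) : R := value s (vreg r).
Definition mode_code (q : mode) : R := (enum_rank q)%:R.
Definition has_mode s q : Prop := value s vmode = mode_code q.

Lemma mode_code_inj : injective mode_code.
Proof.
move=> p q /eqP; rewrite /mode_code eqr_nat => /eqP h.
by apply: enum_rank_inj; apply: val_inj.
Qed.

Definition start_mode : mode := Some (Tm, false, Some true).
Definition start_regs : reg -> R := regs 0 0 0 0 0 0 0.

Definition initial s : Prop :=
  has_mode s start_mode /\ forall r, registers s r = start_regs r.

Definition final s : Prop := has_mode s None /\ registers s Rl = registers s Rq.

Definition stored_dot s : R := \sum_c value s (vfst c) * value s (vsnd c).

Definition moves (bit : bool) s s' : Prop :=
  exists q q', [/\ has_mode s q, has_mode s' q' &
    read (stored_dot s) bit q q' (registers s) (registers s')].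

Definition same_memory a b : Prop :=
  (registers a Ri = registers b Ri -> forall c, value a (vfst c) = value b (vfst c)) /\
  (registers a Rj = registers b Rj -> forall c, value a (vsnd c) = value b (vsnd c)).

(* [a] is the state right after [b]; the symbol at the position of [a] is the
   one read in between. *)
Definition consecutive (x1 x2 : info) a b : Prop :=
  (x2 = None -> initial b) /\
  match x1 with
  | Some (Some bit) => moves bit b a
  | Some None => final b
  | None => True
  end.

Definition compatible (adj : bool) x1 x2 a b : Prop :=
  same_memory a b /\ (adj -> consecutive x1 x2 a b).

(** The modes range over a finite type, so a guessed transition is a finite disjunction of
    polynomial conditions. *)
Lemma compatible_definable adj x1 x2 :
  exists phi : formula (d + d), forall a b, holds (join a b) phi <-> compatible adj x1 x2 a b.
Proof.
pose va (x : 'I_(d + d) -> R) (i : 'I_d) := x (lshift d i).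
pose vb (x : 'I_(d + d) -> R) (i : 'I_d) := x (rshift d i).
suff [phi h] : definable (fun x => compatible adj x1 x2 (va x) (vb x)).
  exists phi => a b; rewrite h.
  suff [-> ->] : va (join a b) = a /\ vb (join a b) = b by [].
  by split; apply: funext => i; rewrite /va /vb /join ?split_lshift ?split_rshift //;
    case: split_ordP => j /eqP; rewrite ?eq_shift // => /eqP ->.
have pa v : polyfun (fun x => value (va x) v) by exact: polyfun_var.
have pb v : polyfun (fun x => value (vb x) v) by exact: polyfun_var.
have ra r : polyfun (fun x => registers (va x) r) by exact: pa.
have rb r : polyfun (fun x => registers (vb x) r) by exact: pb.
apply: definable_and.
  apply: definable_and; apply: definable_imply; try exact: definable_eq.
    by apply: definable_forall => c; apply: definable_eq.
  by apply: definable_forall => c; apply: definable_eq.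
apply: definable_imply; first exact: definable_const.
apply: definable_and.
  apply: definable_imply; first exact: definable_const.
  apply: definable_and; first by apply: definable_eq => //; exact: polyfun_nat.
  apply: definable_forall => -[]; apply: definable_eq => //=; prove_polyfun.
case: x1 => [[bit|]|]; last exact: definable_const.
  apply: definable_exists => q; apply: definable_exists => q'.
  apply: definable_and3; try by apply: definable_eq => //; exact: polyfun_nat.
  apply: definable_read => //; apply: polyfun_sum => c; exact: polyfunM.
apply: definable_and; first by apply: definable_eq => //; exact: polyfun_nat.
exact: definable_eq.
Qed.

Fixpoint chain (l : seq (info * vector)) : Prop :=
  if l is (x1, a) :: l' then
    (if l' is (x2, b) :: _ then consecutive x1 x2 a b else True) /\ chain l'
  else True.

Lemma chain_final a b (l : seq info) (B : seq vector) :
  chain ((Some None, a) :: zip (rcons l None) (b :: B)) -> final b.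
Proof. by case: l => [|x l] [[_ h] _]. Qed.

Lemma all_pairs_chain l : all_pairs compatible l -> chain l.
Proof.
elim: l => // -[x1 a] l IH [h /IH hl]; split=> //.
by case: l h {hl IH} => // -[x2 b] l [[_ h] _]; apply: h.
Qed.

Lemma pairs_with_memory adj x1 a (l : seq (info * vector)) z :
  pairs_with compatible adj x1 a l -> List.In z l -> same_memory a z.2.
Proof.
by elim: l adj => // -[x2 b] l IH adj [[h _] hl] [<- //|]; apply: IH hl.
Qed.

Lemma same_memory_sym a b : same_memory a b -> same_memory b a.
Proof. by move=> [h1 h2]; split=> E c; [rewrite h1 | rewrite h2]. Qed.

Lemma all_pairs_memory l y z : all_pairs compatible l ->
  List.In y l -> List.In z l -> same_memory y.2 z.2.
Proof.
elim: l => // -[x a] l IH [h hl] [<-|Hy] [<-|Hz] //.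
- exact: pairs_with_memory h Hz.
- apply: same_memory_sym; exact: pairs_with_memory h Hy.
- exact: IH.
Qed.

(** Agreement makes the stored vector a function of the register; it is extended by 0 to the reals
    that do not occur. *)
Lemma memory_exists (v : 'I_k -> var) (l : seq (info * vector)) r :
  (forall y z, List.In y l -> List.In z l ->
     registers y.2 r = registers z.2 r -> forall c, value y.2 (v c) = value z.2 (v c)) ->
  exists F : R -> 'I_k -> R, forall z, List.In z l ->
    forall c, F (registers z.2 r) c = value z.2 (v c).
Proof.
move=> H.
have Hx (t : R) : exists f : 'I_k -> R, forall z, List.In z l -> registers z.2 r = t ->
    forall c, f c = value z.2 (v c).
  have [[y [Hy <-]]|N] := EM (exists y, List.In y l /\ registers y.2 r = t).
    by exists (fun c => value y.2 (v c)) => z Hz /esym E; apply: H.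
  by exists (fun=> 0) => z Hz E; case: N; exists z.
have [F HF] := choice Hx.
by exists F => z Hz c; apply: HF.
Qed.

(** Backward induction along the run: [b] is the state after [rev u] has been read, and [v] is
    accepted from it. The extra position [(x1, a)] in front gives access to the initial condition on
    [b] when [u] is empty. *)
Lemma chain_accepts (F G : R -> 'I_k -> R) (u v : seq bool) x1 (B : seq vector) a b :
  let l := (x1, a) :: zip (rcons [seq Some (Some c) | c <- u] None) (b :: B) in
  size B = size u -> chain l ->
  (forall z, List.In z l -> dot F G (registers z.2) = stored_dot z.2) ->
  forall q, has_mode b q -> accepts F G q (registers b) v ->
  accepts F G start_mode start_regs (catrev u v).
Proof.
elim: u v x1 B a b => [|bit u IH] v x1 [|b' B] a b //= sB ch Hd q hq acc.
  have [[/(_ erefl) [hm hr] _] _] := ch.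
  have -> : start_mode = q by apply: mode_code_inj; rewrite -hq -hm.
  by have <- : registers b = start_regs by apply: funext.
case: sB => sB; case: ch => _ ch.
have [p [p' [hp hp' rd]]] : moves bit b' b.
  by move: ch => [+ _]; case: (u) => [|c u'] /= [_].
apply: (IH (bit :: v) (Some (Some bit)) B b b' sB ch _ p) => //.
  by move=> z hz; apply: Hd; right.
exists p', (registers b); split; last first.
  by rewrite (_ : p' = q) //; apply: mode_code_inj; rewrite -hq -hp'.
suff -> : dot F G (registers b') = stored_dot b' by [].
case: (u) Hd => [|c u'] /= Hd.
  by apply: (Hd (None, b')); right; right; left.
by apply: (Hd (Some (Some c), b')); right; right; left.
Qed.

Variables (F G : R -> 'I_k -> R).

Definition state (q : mode) (s : reg -> R) : vector := fun i =>
  match enum_val i with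
  | inl None => mode_code q
  | inl (Some r) => s r
  | inr (inl c) => F (s Ri) c
  | inr (inr c) => G (s Rj) c
  end.

Lemma value_state q (s : reg -> R) v : value (state q s) v =
  match v with
  | inl None => mode_code q
  | inl (Some r) => s r
  | inr (inl c) => F (s Ri) c
  | inr (inr c) => G (s Rj) c
  end.
Proof. by rewrite /value /state enum_rankK. Qed.

Lemma registers_state q (s : reg -> R) : registers (state q s) = s.
Proof. by apply: funext => r; rewrite /registers value_state. Qed.

Lemma stored_dot_state q (s : reg -> R) : stored_dot (state q s) = dot F G s.
Proof. by apply: eq_bigr => c _; rewrite !value_state. Qed.

Lemma same_memory_state q (s : reg -> R) q' (s' : reg -> R) :
  same_memory (state q s) (state q' s').
Proof.
by split; rewrite !registers_state => E c; rewrite !value_state E.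
Qed.

Notation states Z := [seq state z.1 z.2 | z <- Z].

(** All vectors read the same [F] and [G], so the memory condition holds for every pair and only
    neighbours need checking. *)
Lemma chain_all_pairs (xs : seq info) (Z : seq (mode * (reg -> R))) :
  chain (zip xs (states Z)) -> all_pairs compatible (zip xs (states Z)).
Proof.
elim: xs Z => [|x xs IH] [|z Z] //= [h /IH hl]; split=> // {IH hl}.
have far adj : adj = false -> forall ys Y,
    pairs_with compatible adj x (state z.1 z.2) (zip ys (states Y)).
  move=> ->; elim=> [|y ys IH] [|u Y] //=; split=> //.
  by split=> //; apply: same_memory_state.
case: xs Z h => [|x2 xs] [|z2 Z] //= h; split; last exact: far.
by split=> [|_]; [exact: same_memory_state | exact: h].
Qed.

(** Forward construction: [(q, s)] is reached after reading [rev u], and [Z] lists the earlier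
    states, latest first. *)
Lemma accepts_chain (u v : seq bool) (q : mode) (s : reg -> R) (Z : seq (mode * (reg -> R))) :
  size Z = size u -> (u = [::] -> q = start_mode /\ s = start_regs) ->
  chain (zip (rcons [seq Some (Some c) | c <- u] None) (states ((q, s) :: Z))) ->
  accepts F G q s v ->
  exists2 Z' : seq (mode * (reg -> R)), size Z' = (size (catrev v u)).+2 &
    chain (zip (Some None :: rcons [seq Some (Some c) | c <- catrev v u] None) (states Z')).
Proof.
elim: v u q s Z => [|bit v IH] u q s Z sZ hu ch /=.
  have hi x : x = head None (rcons [seq Some (Some c) | c <- u] None) ->
      x = None -> initial (state q s).
    move=> ->; case: (u) hu => // /(_ erefl) [-> ->] _.
    by split=> [|r]; rewrite ?registers_state // /has_mode value_state.
  (* The vector at the right end marker is bound only by the memory condition, so the last state is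
     repeated there. *)
  move=> [Eq El]; exists ((q, s) :: (q, s) :: Z); rewrite /= ?sZ //.
  split; last exact: ch.
  have hf : final (state q s) by split; rewrite ?registers_state // /has_mode value_state Eq.
  by case: (u) hi => [|c u'] /= hi; split=> //; apply: hi.
move=> [q' [s' [rd acc]]].
apply: (IH (bit :: u) q' s' ((q, s) :: Z)) => //=; first by rewrite sZ.
split; last exact: ch.
have hm : moves bit (state q s) (state q' s').
  exists q, q'; rewrite stored_dot_state !registers_state /has_mode !value_state.
  by split.
case: (u) hu => [|c u'] /= hu; split=> // _.
have [-> ->] := hu erefl.
by split=> [|r]; rewrite ?registers_state // /has_mode value_state.
Qed.
End Runs.

Lemma runs_accepts (R : realType) (k : nat) (w : seq bool) :
  (exists2 B : seq ('I_#|var k| -> R), size B = size (infos w) &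
     all_pairs (@compatible R k) (zip (infos w) B)) <->
  exists F G : R -> 'I_k -> R, accepts F G start_mode (start_regs R) w.
Proof.
split=> [[B sB hB]|[F [G acc]]].
  have mem y z := @all_pairs_memory R k _ y z hB.
  have [F hF] := @memory_exists R k (@vfst k) _ Ri (fun y z hy hz => (mem y z hy hz).1).
  have [G hG] := @memory_exists R k (@vsnd k) _ Rj (fun y z hy hz => (mem y z hy hz).2).
  have dotE z : List.In z (zip (infos w) B) -> dot F G (registers z.2) = stored_dot z.2.
    by move=> hz; apply: eq_bigr => c _; rewrite hF ?hG.
  exists F, G; move: sB (all_pairs_chain hB) dotE.
  rewrite size_infos /infos -map_rev; case: B {hB mem hF hG} => [|a [|b B]] //= [sB] ch dotE.
  have := @chain_accepts R k F G (rev w) [::] (Some None) B a b.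
  rewrite catrevE revK cats0 size_rev => /(_ sB ch dotE).
  by have [hm hl] := chain_final ch; move=> /(_ None hm); apply; split.
have [//|//|Z sZ ch] :=
  @accepts_chain R k F G [::] w start_mode (start_regs R) [::] erefl _ _ acc.
exists [seq state F G z.1 z.2 | z <- Z].
  by rewrite size_map sZ size_infos catrevE cats0 size_rev.
apply: chain_all_pairs; move: ch; rewrite catrevE cats0.
by rewrite /infos map_rev.
Qed.

(** * Low rank as a factorization *)

Section Rank.
Local Open Scope ring_scope.

(** Gaussian elimination writes [X] around [pid_mx (\rank X)], which factors through dimension [k]
    as soon as the rank is at most [k]. *)
Lemma rank_leP (K : fieldType) (k m n : nat) (X : 'M[K]_(m, n)) :
  (\rank X <= k)%N <-> exists (U : 'M_(m, k)) (V : 'M_(k, n)), X = U *m V.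
Proof.
split=> [h|[U [V ->]]]; last exact: mulmx_max_rank.
exists (col_ebase X *m pid_mx (\rank X)), (pid_mx (\rank X) *m row_ebase X).
by rewrite mulmxA -(mulmxA (col_ebase X)) pid_mx_id // mulmx_ebase.
Qed.

(** Natural numbers embed injectively in [R], so the prescribed values do not conflict; elsewhere
    the value is [t0]. *)
Lemma real_indexing (R : numDomainType) (T : Type) (t0 : T) (m : nat) (f : 'I_m -> T) :
  exists F : R -> T, forall i : 'I_m, F i%:R = f i.
Proof.
exists (fun t => if [pick i : 'I_m | i%:R == t] is Some i then f i else t0) => i.
case: pickP => [j|/(_ i)]; last by rewrite eqxx.
by rewrite eqr_nat => /eqP /val_inj ->.
Qed.

Lemma arm_feasibleP (R : realType) (k : nat) (I : arm_instance) :
  arm_feasible R k I <-> exists F G : R -> 'I_k -> R, arm_equations F G I.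
Proof.
split=> [[X [eqX /rank_leP [U [V E]]]]|[F [G H]]].
  have [F hF] := @real_indexing R _ (fun=> 0) _ (fun i c => U i c).
  have [G hG] := @real_indexing R _ (fun=> 0) _ (fun j c => V c j).
  exists F, G => l; rewrite -eqX /mxdot; apply: eq_bigr => i _; apply: eq_bigr => j _.
  rewrite mxE E mxE; congr (_ * _); apply: eq_bigr => c _.
  by rewrite hF hG.
pose U : 'M[R]_(arm_m I, k) := \matrix_(i, c) F i%:R c.
pose V : 'M[R]_(k, arm_n I) := \matrix_(c, j) G j%:R c.
exists (U *m V); split; last by apply/rank_leP; exists U, V.
move=> l; rewrite -H; apply: eq_bigr => i _; apply: eq_bigr => j _.
by rewrite !mxE; congr (_ * _); apply: eq_bigr => c _; rewrite !mxE.
Qed.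
End Rank.

Theorem theorem3p2 (R : realType) (k : nat) (hk : (1 <= k)%N) :
  in_existsR R (ARM R k).
Proof.
(* The finite table of formulas is fixed once and for all; it depends on [k] but not on the
   input. *)
have [T hT] := choice (fun z : bool * info * info =>
  @compatible_definable R k z.1.1 z.1.2 z.2).
have [f pf hf] := pair_formula_polytime R (fun adj x1 x2 => T (adj, x1, x2)).
exists f => // w; rewrite hf.
have -> : @pair_holds R _ (fun adj x1 x2 => T (adj, x1, x2)) = @compatible R k.
  do 5!apply: funext => ?; apply: propext; exact: hT.
rewrite runs_accepts; split=> [[I Ew /arm_feasibleP [F [G H]]]|[F [G /accepts_arm [I Ew H]]]].
  by exists F, G; apply/accepts_arm; exists I.
by exists I => //; apply/arm_feasibleP; exists F, G.
Qed.
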